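(* Let $f:X\to Y$ be a local quasi-isometry between complete metric spaces, and suppose that $Y$ is path-connected and locally $\mathcal R$-contractible. Then the following are equivalent: (1) $f$ is a covering projection; (2) $f$ has the continuation property for every rectifiable path $p:[0,1]\to Y$; (3) for every continuous path $q:[a,b)\to X$, $\ell(q)<\infty$ whenever $\ell(f\circ q)<\infty$; (4) $f$ has the bounded path-lifting property for every rectifiable path $p:[0,1]\to Y$; (5) there is a weight $\omega$ such that $f$ has the bounded path-lifting property with respect to $\omega$ for every rectifiable path $p:[0,1]\to Y$. If in addition $X$ is connected and either $Y$ is simply connected or the fundamental groups $\pi_1(X)$ and $\pi_1(Y)$ are isomorphic and finite, then (1)–(5) are also equivalent to each of: (6) $f$ is a homeomorphism of $X$ onto $Y$; (7) $f$ is proper; (8) for every compact $K\subset Y$ there is $\alpha_K>0$ such that $D_x^-f\ge\alpha_K$ for every $x\in f^{-1}(K)$.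
   Context: Length of a path $p:[a,b]\to Y$: $\ell(p)=\sup\sum_i d(p(t_i),p(t_{i+1}))$ over partitions of $[a,b]$; for a path $q:[a,b)\to X$, $\ell(q)=\lim_{t\to b^-}\ell(q|_{[a,t]})$; a path is rectifiable if its length is finite. For non-isolated $x\in X$, $D_x^-f=\liminf_{z\to x,\,z\neq x}\frac{d(f(z),f(x))}{d(z,x)}$ and $D_x^+f=\limsup_{z\to x,\,z\neq x}\frac{d(f(z),f(x))}{d(z,x)}$; $X$ is assumed to have no isolated points. A map $g:V\to W$ between metric spaces is a quasi-isometry if it is a homeomorphism and there are $0<\alpha\le\beta<\infty$ with $\alpha\le\inf_{x\in V}D_x^-g\le\sup_{x\in V}D_x^+g\le\beta$; $f$ is a local quasi-isometry if every $x\in X$ has open neighborhoods $V$ of $x$ and $W$ of $f(x)$ with $f|_V:V\to W$ a quasi-isometry. $Y$ is locally $\mathcal R$-contractible if every $y_0\in Y$ has an open neighborhood $U$ with a continuous homotopy $H:U\times[0,1]\to U$ with $H(y_0,t)=y_0$, $H(y,0)=y_0$, $H(y,1)=y$, and each path $t\mapsto H(y,t)$ rectifiable. Continuation property for $p:[0,1]\to Y$: for every $b\in(0,1]$ and continuous $q:[0,b)\to X$ with $f\circ q=p$ on $[0,b)$ there is $t_n\to b$ in $[0,b)$ with $(q(t_n))$ convergent. Bounded path-lifting property for $p$: for every such $b,q$ there is $\alpha>0$ with $\inf\{D_x^-f:x\in\operatorname{Im}q\}\ge\alpha$. A weight is a nondecreasing map $\omega:[0,\infty)\to(0,\infty)$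 with $\int_0^\infty dt/\omega(t)=\infty$; bounded path-lifting property for $p$ with respect to $\omega$: for every such $b,q$ there are $x_0\in X$, $\alpha>0$ with $\inf\{D_x^-f\cdot\omega(d(x,x_0)):x\in\operatorname{Im}q\}\ge\alpha$. $f$ is proper if preimages of compact sets are compact. *)

(* Defs.v *)
From HB Require Import structures.
From mathcomp Require Import all_boot all_order all_algebra.
From mathcomp Require Import all_classical all_reals all_analysis.
Set Implicit Arguments. Unset Strict Implicit. Unset Printing Implicit Defensive.
Import Order.TTheory GRing.Theory Num.Theory.
Import numFieldNormedType.Exports.
Local Open Scope classical_set_scope.
Local Open Scope ring_scope.

Section Defs.
Context {R : realType}.

Definition complete_metric (T : metricType R) : Prop :=
  forall u : nat -> T,
    (forall e : R, 0 < e -> exists N : nat, forall m n : nat,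
        (N <= m)%N -> (N <= n)%N -> mdist (u m) (u n) < e) ->
    exists l : T, u @ \oo --> l.

Definition no_isolated_points (T : metricType R) : Prop :=
  forall (x : T) (e : R), 0 < e -> exists z : T, z <> x /\ mdist z x < e.

(** Length of a path [p : [a,b] -> T] (values of [p] outside [a,b] are
    irrelevant): supremum over partitions a = t_0 <= ... <= t_n = b. *)
Definition path_length (T : metricType R) (p : R -> T) (a b : R) : \bar R :=
  ereal_sup [set s | exists (n : nat) (t : nat -> R),
     [/\ t 0%N = a, t n = b, (forall i, (i < n)%N -> t i <= t i.+1) &
         s = (\sum_(0 <= i < n) mdist (p (t i)) (p (t i.+1)))%:E]].

(** Length of a path [q : [a,b) -> T]: the (monotone) limit, as t -> b^-,
    of the lengths of the restrictions [q|[a,t]], written as a supremum. *)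
Definition hpath_length (T : metricType R) (q : R -> T) (a b : R) : \bar R :=
  ereal_sup [set path_length q a t | t in `[a, b[%classic].

(** Lower/upper derivative-like quantities of [f] at [x], relative to a set
    [A] (z ranges over A, z <> x):  liminf / limsup of d(f z, f x)/d(z, x). *)
Definition dratio (X Y : metricType R) (f : X -> Y) (x z : X) : \bar R :=
  (mdist (f z) (f x) / mdist z x)%:E.

Definition punct_ball (X : metricType R) (A : set X) (x : X) (r : R) : set X :=
  [set z | A z /\ 0 < mdist z x < r].

Definition Dminus_in (X Y : metricType R) (A : set X) (f : X -> Y) (x : X)
  : \bar R :=
  ereal_sup [set ereal_inf (dratio f x @` punct_ball A x r) | r in [set r : R | 0 < r]].

Definition Dplus_in (X Y : metricType R) (A : set X) (f : X -> Y) (x : X)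
  : \bar R :=
  ereal_inf [set ereal_sup (dratio f x @` punct_ball A x r) | r in [set r : R | 0 < r]].

Definition Dminus (X Y : metricType R) (f : X -> Y) (x : X) : \bar R :=
  Dminus_in setT f x.

Definition homeo_on (X Y : metricType R) (f : X -> Y) (V : set X) (W : set Y)
  : Prop :=
  [/\ f @` V = W, {within V, continuous f} &
      exists g : Y -> X, [/\ g @` W = V, (forall x, V x -> g (f x) = x),
                             (forall y, W y -> f (g y) = y) &
                             {within W, continuous g}]].

Definition quasi_isometry_on (X Y : metricType R) (f : X -> Y)
  (V : set X) (W : set Y) : Prop :=
  homeo_on f V W /\
  exists alpha beta : R, [/\ 0 < alpha, alpha <= beta &
     forall x, V x -> ((alpha%:E <= Dminus_in V f x)%E /\ (Dplus_in V f x <= beta%:E)%E)].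

Definition local_quasi_isometry (X Y : metricType R) (f : X -> Y) : Prop :=
  forall x : X, exists (V : set X) (W : set Y),
    [/\ open V, V x, open W, W (f x) & quasi_isometry_on f V W].

Definition is_path01 (T : metricType R) (p : R -> T) : Prop :=
  {within `[0, 1]%classic, continuous p}.

Definition path_connected (T : metricType R) : Prop :=
  forall x y : T, exists p : R -> T, [/\ is_path01 p, p 0 = x & p 1 = y].

Definition rectifiable_path01 (T : metricType R) (p : R -> T) : Prop :=
  is_path01 p /\ (path_length p 0 1 < +oo)%E.

Definition locally_R_contractible (T : metricType R) : Prop :=
  forall y0 : T, exists U : set T, open U /\ U y0 /\
    exists H : T * R -> T,
      [/\ {within U `*` `[0, 1]%classic, continuous H},
          (forall y t, U y -> 0 <= t <= 1 -> U (H (y, t))),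
          (forall t, 0 <= t <= 1 -> H (y0, t) = y0),
          (forall y, U y -> H (y, 0) = y0 /\ H (y, 1) = y) &
          (forall y, U y -> (path_length (fun t => H (y, t)) 0 1 < +oo)%E)].

Definition lift_on (X Y : metricType R) (f : X -> Y) (p : R -> Y) (b : R)
  (q : R -> X) : Prop :=
  {within `[0, b[%classic, continuous q} /\
  (forall t, 0 <= t < b -> f (q t) = p t).

Definition continuation_property (X Y : metricType R) (f : X -> Y)
  (p : R -> Y) : Prop :=
  forall (b : R) (q : R -> X), 0 < b <= 1 -> lift_on f p b q ->
    exists t : nat -> R, [/\ (forall n, 0 <= t n < b), t @ \oo --> b &
                             exists l : X, (q \o t) @ \oo --> l].

Definition bounded_path_lifting (X Y : metricType R) (f : X -> Y)
  (p : R -> Y) : Prop :=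
  forall (b : R) (q : R -> X), 0 < b <= 1 -> lift_on f p b q ->
    exists alpha : R, 0 < alpha /\
      forall x, (q @` `[0, b[%classic) x -> (alpha%:E <= Dminus f x)%E.

Definition weight (w : R -> R) : Prop :=
  [/\ (forall s t, 0 <= s -> s <= t -> w s <= w t),
      (forall t, 0 <= t -> 0 < w t) &
      (\int[lebesgue_measure]_(t in `[0%R, +oo[%classic) ((w t)^-1)%:E = +oo)%E].

Definition bounded_path_lifting_w (X Y : metricType R) (f : X -> Y)
  (w : R -> R) (p : R -> Y) : Prop :=
  forall (b : R) (q : R -> X), 0 < b <= 1 -> lift_on f p b q ->
    exists (x0 : X) (alpha : R), 0 < alpha /\
      forall x, (q @` `[0, b[%classic) x ->
        (alpha%:E <= Dminus f x * (w (mdist x x0))%:E)%E.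

Definition covering_projection (X Y : metricType R) (f : X -> Y) : Prop :=
  [/\ continuous f, f @` setT = setT &
      forall y : Y, exists U : set Y, [/\ open U, U y &
        exists P : set (set X),
          [/\ f @^-1` U = \bigcup_(V in P) V,
              (forall V, P V -> open V /\ homeo_on f V U) &
              (forall V V', P V -> P V' -> V `&` V' !=set0 -> V = V')]]].

Definition homeomorphism (X Y : metricType R) (f : X -> Y) : Prop :=
  homeo_on f setT setT.

Definition proper_map (X Y : metricType R) (f : X -> Y) : Prop :=
  forall K : set Y, compact K -> compact (f @^-1` K).

Definition loop_at (T : metricType R) (x0 : T) (g : R -> T) : Prop :=
  [/\ is_path01 g, g 0 = x0 & g 1 = x0].

Definition loop_homotopic (T : metricType R) (x0 : T) (g h : R -> T) : Prop :=
  exists H : R * R -> T,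
    [/\ {within `[0, 1]%classic `*` `[0, 1]%classic, continuous H},
        (forall s, 0 <= s <= 1 -> H (s, 0) = g s /\ H (s, 1) = h s) &
        (forall t, 0 <= t <= 1 -> H (0, t) = x0 /\ H (1, t) = x0)].

Definition loop_concat (T : metricType R) (g h : R -> T) : R -> T :=
  fun s => if s <= 2^-1 then g (2 * s) else h (2 * s - 1).

(** pi_1(X, x0) and pi_1(Y, y0) are isomorphic groups: a map on loops that
    is well defined, injective and surjective on homotopy classes, and a
    homomorphism for concatenation. *)
Definition pi1_isomorphic (X Y : metricType R) (x0 : X) (y0 : Y) : Prop :=
  exists phi : (R -> X) -> (R -> Y),
    [/\ (forall g, loop_at x0 g -> loop_at y0 (phi g)),
        (forall g h, loop_at x0 g -> loop_at x0 h ->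
           (loop_homotopic x0 g h <-> loop_homotopic y0 (phi g) (phi h))),
        (forall k, loop_at y0 k -> exists g, loop_at x0 g /\
           loop_homotopic y0 (phi g) k) &
        (forall g h, loop_at x0 g -> loop_at x0 h ->
           loop_homotopic y0 (phi (loop_concat g h))
                             (loop_concat (phi g) (phi h)))].

Definition pi1_finite (T : metricType R) (x0 : T) : Prop :=
  exists (n : nat) (g : nat -> R -> T),
    (forall i, (i < n)%N -> loop_at x0 (g i)) /\
    forall h, loop_at x0 h -> exists i, (i < n)%N /\ loop_homotopic x0 h (g i).

Definition simply_connected (T : metricType R) : Prop :=
  path_connected T /\
  forall (x0 : T) g, loop_at x0 g -> loop_homotopic x0 g (fun _ => x0).

End Defs.

(* Main.v *)
Require Import Defs.
From HB Require Import structures.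
From mathcomp Require Import all_boot all_order all_algebra.
From mathcomp Require Import all_classical all_reals all_analysis.
From mathcomp Require Import measurable_realfun ring lra.
Import Order.TTheory GRing.Theory Num.Theory.
Import numFieldNormedType.Exports.
Local Open Scope classical_set_scope.
Local Open Scope ring_scope.
Set Implicit Arguments.
Unset Strict Implicit.

(** If D^- f >= alpha along a lift q, then d(q s, q t) is at most 1/alpha times the
    arc length of f o q between s and t, so lifts of rectifiable paths have finite
    length and converge at their right end by completeness; conversely a lift
    with an accumulation point at b is given near b by a local section of f, so
    its image has compact closure and D^- f is bounded below on it. For a weight w,
    moving the distance to x0 from n to n+1 costs at least alpha/(2 w(n+1)) of arc
    length; since the series of 1/w(n) diverges, the lift stays in a ball.

    An R-contraction of a neighbourhood U of y0 is made of rectifiable paths from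
    y0. Lifting them from each point x of the fibre over y0 gives a section of f on
    U, continuous by homotopy lifting, and these sections are the sheets over U.

    When X is connected, the same sheets show that it is path connected. If loops
    of Y are contractible, the image of a path joining two points of a fibre lifts
    to a closed path. If pi_1(X) and pi_1(Y) are isomorphic and finite, the
    injective map induced by f on fundamental groups is onto, with the same
    conclusion; so f is injective. *)

(** * Induction on real intervals *)

Section RealLine.
Context {R : realType}.
Implicit Types (a b t : R).

(** Paths live on intervals, but the proof works on the whole line: they are precomposed with
    [clamp] or [Num.max 0], so that uniqueness, gluing and extension of lifts concern continuity at
    points rather than subspace topologies. Length enters through [dominated], where a real function
    whose increments bound those of the path stands in for its arc length. A path has no derivative
    to integrate, so a bound on D^- f becomes a bound on increments by induction along the interval,
    each step using only the expansion of [f] near one point.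

    Conditions (2) to (5) concern paths of finite length in Y, while homotopies of loops consist of
    merely continuous paths. The step to injectivity therefore starts from (1), under which all
    continuous paths lift.

    The isomorphism of fundamental groups is arbitrary, with base points unrelated to [f]. Loops are
    carried to the right base point by conjugation, and counting group elements is replaced by a
    pigeonhole argument on a finite list of representatives. *)

Lemma nbhs_realP (t : R) (N : set R) :
  nbhs t N <-> exists2 d : R, 0 < d & forall s, `|s - t| < d -> N s.
Proof.
split=> [/nbhs_ballP[d /= d0 dN]|[d d0 dN]].
  by exists d => // s st; apply: dN; rewrite /ball/= distrC.
by apply/nbhs_ballP; exists d => //= s; rewrite /ball/= distrC => /dN.
Qed.

(** The supremum of the points related to [a] is itself related to [a] by the left condition, and
    equals [b] by the right one. A transitive relation, rather than a predicate, covers both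
    increments chained by the triangle inequality and implications between predicates. *)
Lemma real_induction (Q : R -> R -> Prop) (a b : R) : a <= b ->
  (forall t, a <= t <= b -> exists2 d, 0 < d &
     (forall s, a <= s <= t -> t - s < d -> Q s t) /\
     (forall s, t <= s <= b -> s - t < d -> Q t s)) ->
  (forall s t u, Q s t -> Q t u -> Q s u) -> Q a b.
Proof.
move=> ab loc tr.
pose S := [set t | a <= t <= b /\ Q a t].
have Sa : S a.
  have [|d d0 [_ H]] := loc a; first by rewrite lexx ab.
  by split; [rewrite lexx ab|apply: H; rewrite ?lexx ?ab ?subrr].
have ubS : ubound S b by move=> t [/andP[]].
have hS : has_sup S by split; [exists a|exists b].
pose c := sup S.
have ac : a <= c by apply: ub_le_sup Sa; exists b.
have cb : c <= b by apply: ge_sup; [exists a|].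
have [|d d0 [Hl Hr]] := loc c; first by rewrite ac cb.
have Sc : Q a c.
  have [t [/andP[at_ tb] Qat] ct] := sup_adherent d0 hS.
  apply: (tr _ _ _ Qat); apply: Hl; last by rewrite -/c in ct; lra.
  rewrite at_ /=; apply: ub_le_sup; first by exists b.
  by split=> //; rewrite at_ tb.
have [cb'|bc] := ltP c b; last by have -> : b = c by apply/le_anti; rewrite bc cb.
pose e := Num.min b (c + d / 2).
have ce : c < e by rewrite /e lt_min cb' ltrDl divr_gt0.
have eb : e <= b by rewrite /e ge_min lexx.
have : e <= c.
  apply: ub_le_sup; first by exists b.
  split; first by rewrite eb (le_trans ac (ltW ce)).
  apply: (tr _ _ _ Sc); apply: Hr; first by rewrite (ltW ce) eb.
  have : e <= c + d / 2 by rewrite /e ge_min lexx orbT.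
  lra.
by rewrite leNgt ce.
Qed.

(** Real induction for [P s <-> P t]: the equivalence lets the predicate spread leftwards as well as
    rightwards. *)
Lemma interval_induction (P : R -> Prop) (a b : R) :
  (forall t, a <= t <= b -> exists2 d, 0 < d & forall u v, a <= u <= b -> a <= v <= b ->
    `|u - t| < d -> `|v - t| < d -> P u -> P v) ->
  forall u v, a <= u <= b -> a <= v <= b -> P u -> P v.
Proof.
move=> loc u v abu abv.
have H u' v' : a <= u' <= b -> a <= v' <= b -> u' <= v' -> P u' <-> P v'.
    move=> /andP[au _] /andP[_ vb] uv.
    apply: (real_induction (Q := fun s t => P s <-> P t)) uv _ _; last first.
      by move=> s t w [? ?] [? ?]; split; auto.
    move=> t /andP[ut tv]; have abt : a <= t <= b by apply/andP; split; lra.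
    have [d d0 H] := loc t abt; exists d => //.
    by split=> s /andP[h1 h2] h3; split; apply: H => //;
      rewrite ?subrr ?normr0// ?ltr_norml; try (apply/andP; split); lra.
  by have [uv|vu] := leP u v; [move/(H _ _ abu abv uv)|move/(H _ _ abv abu (ltW vu))].
Qed.

End RealLine.

Lemma continuous_atP (S T : topologicalType) (q : S -> T) (s : S) :
  {for s, continuous q} <-> forall N, nbhs (q s) N -> nbhs s (q @^-1` N).
Proof. by split=> cq N; exact: cq. Qed.

(** * Neighbourhoods and limits in terms of the distance *)

Section Metric.
Context {R : realType} {T : metricType R}.

Lemma nbhs_mdistP (x : T) (N : set T) :
  nbhs x N <-> exists2 d : R, 0 < d & forall z, mdist z x < d -> N z.
Proof.
split=> [/nbhs_ballP[d /= d0 dN]|[d d0 dN]].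
  by exists d => // s st; apply: dN; rewrite ballEmdist/= metric_sym.
by apply/nbhs_ballP; exists d => //= s; rewrite ballEmdist/= metric_sym => /dN.
Qed.

Lemma cvg_mdistP (u : nat -> T) (l : T) : u @ \oo --> l <->
  forall e : R, 0 < e -> exists N, forall n, (N <= n)%N -> mdist (u n) l < e.
Proof.
split=> [ul e e0|H A /nbhs_mdistP[d d0 dA]].
  have : nbhs l [set z | mdist z l < e] by apply/nbhs_mdistP; exists e.
  by move=> /ul [N _ HN]; exists N.
by have [N HN] := H _ d0; exists N => // n /= /HN /dA.
Qed.

Lemma continuous_mdist_at (S : topologicalType) (q : S -> T) (x : T) (s : S) :
  {for s, continuous q} -> {for s, continuous (fun z => mdist (q z) x)}.
Proof.
move=> /continuous_atP cq; apply/continuous_atP => A /nbhs_realP[d d0 dA].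
have : nbhs (q s) [set z | mdist z (q s) < d] by apply/nbhs_mdistP; exists d.
move=> /cq; apply: filterS => z /= zs; apply: dA => /=.
have h1 := metric_triangle (q z) (q s) x.
have h2 := metric_triangle (q s) (q z) x.
move: h2; rewrite [mdist (q s) (q z)]metric_sym => h2.
by rewrite ltr_norml; apply/andP; split; lra.
Qed.

End Metric.

(** * Paths of finite length *)

Section Length.
Context {R : realType} {T : metricType R}.
Implicit Types (p q : R -> T) (L : R -> R).

(* [p] has finite length on an interval exactly when its increments there are
   controlled by those of a real function (e.g. its arc length). *)
Definition dominated p L (A : set R) :=
  forall s t, A s -> A t -> s <= t -> mdist (p s) (p t) <= L t - L s.

Lemma mono_seq_between (n : nat) (t : nat -> R) :
  (forall i, (i < n)%N -> t i <= t i.+1) ->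
  forall i, (i <= n)%N -> t 0%N <= t i <= t n.
Proof.
move=> mt i im; apply/andP; split.
  by elim: i im => // i IH im; apply: le_trans (IH (ltnW im)) (mt _ im).
have H m : (i <= m)%N -> (m <= n)%N -> t i <= t m.
  elim: m => [|m IH]; first by rewrite leqn0 => /eqP ->.
  rewrite leq_eqVlt => /orP[/eqP ->//|im' mn].
  exact: le_trans (IH im' (ltnW mn)) (mt _ mn).
exact: H.
Qed.

Lemma dominated_length p L a b : dominated p L `[a, b] ->
  (path_length p a b <= (L b - L a)%:E)%E.
Proof.
move=> dom; apply: ge_ereal_sup => _ [n [t [t0 tn mt ->]]].
rewrite lee_fin -t0 -tn -(@telescope_sumr _ 0%N n (L \o t))//=.
rewrite !big_nat; apply: ler_sum => i /andP[_ im].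
have /andP[h1 h2] := mono_seq_between mt (ltnW im).
have /andP[h3 h4] := mono_seq_between mt im.
by apply: dom; rewrite ?mt//= in_itv/= -t0 -tn ?h1 ?h3.
Qed.

Lemma path_length_ge0 p a b : a <= b -> (0 <= path_length p a b)%E.
Proof.
move=> ab; apply: ereal_sup_ge; exists (mdist (p a) (p b))%:E.
  exists 1%N, (fun i => if i is 0%N then a else b); split=> //.
    by case.
  by rewrite big_nat1.
by rewrite lee_fin mdist_ge0.
Qed.

(** Appending [t] to a partition of [a, s] adds one chord. This gives the arc length from [a] the
    property required by [dominated]. *)
Lemma path_length_step p a s t : s <= t ->
  (path_length p a s + (mdist (p s) (p t))%:E <= path_length p a t)%E.
Proof.
move=> st; rewrite -leeBrDr//; apply: ge_ereal_sup => _ [n [u [u0 un mu ->]]].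
rewrite leeBrDr//; apply: ereal_sup_ubound.
exists n.+1, (fun i => if (i <= n)%N then u i else t); split=> //.
- by rewrite ltnn.
- move=> i; rewrite ltnS => im; move: (im); rewrite [(i <= n)%N]leq_eqVlt.
  move=> /orP[/eqP ->|{}im]; first by rewrite eqxx ltnn un.
  by rewrite im orbT mu.
- rewrite big_nat_recr//= leqnn ltnn un EFinD; congr (_%:E + _)%E.
  by rewrite !big_nat; apply: eq_bigr => i /andP[_ im]; rewrite (ltnW im) im.
Qed.

Lemma path_lengthP p a b : a <= b ->
  (path_length p a b < +oo)%E <-> exists L, dominated p L `[a, b].
Proof.
move=> ab; split=> [fin|[L dom]]; last first.
  exact: le_lt_trans (dominated_length dom) (ltry _).
exists (fun t => fine (path_length p a t)) => s t /=; rewrite !in_itv/=.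
move=> /andP[as_ sb] /andP[at_ tb] st.
have fint u : a <= u -> u <= b -> path_length p a u \is a fin_num.
  move=> au ub; rewrite ge0_fin_numE ?path_length_ge0//.
  apply: le_lt_trans fin; apply: le_trans (path_length_step p a ub).
  by rewrite leeDl// lee_fin mdist_ge0.
have := path_length_step p a st.
rewrite -(fineK (fint s as_ sb)) -(fineK (fint t at_ tb)) -EFinD lee_fin; lra.
Qed.

Lemma hpath_lengthP p a b : (hpath_length p a b < +oo)%E <->
  exists L M, dominated p L `[a, b[%classic /\ forall t, a <= t < b -> L t <= M.
Proof.
split=> [fin|[L [M [dom LM]]]]; last first.
  apply: (@le_lt_trans _ _ (M - L a)%:E); last exact: ltry.
  apply: ge_ereal_sup => y [t /=]; rewrite in_itv/= => atb <- {y}.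
  have /andP[at_ tb] := atb.
  apply: (@le_trans _ _ (L t - L a)%:E); last by rewrite lee_fin lerD2r LM.
  apply: dominated_length => s u /=; rewrite !in_itv/= => /andP[? ?] /andP[? ?] ?.
  by apply: dom => //=; rewrite in_itv/=; apply/andP; split=> //; lra.
have le t : a <= t < b -> (path_length p a t <= hpath_length p a b)%E.
  by move=> atb; apply: ereal_sup_ubound; exists t => //=; rewrite in_itv.
have fint t : a <= t < b -> path_length p a t \is a fin_num.
  move=> atb; rewrite ge0_fin_numE ?(le_lt_trans (le _ atb))//.
  by rewrite path_length_ge0//; case/andP: atb.
(* For b <= a the interval is empty and any [L] will do. *)
have [ab|ba] := ltP a b; last first.
  exists (cst 0), 0; split=> [s t /=|t]; rewrite ?in_itv/= => /andP[h1 h2]; lra.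
have aab : a <= a < b by rewrite lexx ab.
have hfin : hpath_length p a b \is a fin_num.
  by rewrite ge0_fin_numE// (le_trans _ (le _ aab))// path_length_ge0.
exists (fun t => fine (path_length p a t)), (fine (hpath_length p a b)); split.
  move=> s t /=; rewrite !in_itv/= => sab tab st.
  have := path_length_step p a st.
  by rewrite -(fineK (fint s sab)) -(fineK (fint t tab)) -EFinD lee_fin; lra.
by move=> t tab; rewrite fine_le ?fint// le.
Qed.

Lemma dominatedS p L (A B : set R) : A `<=` B -> dominated p L B -> dominated p L A.
Proof. by move=> AB d s t /AB As /AB At; exact: d. Qed.

(** The nondecreasing [L] comes within e of its supremum before [b], which gives the Cauchy
    criterion at [b]. Completeness being stated for sequences, the limit is taken along b - (b - a)
    / (n + 1), then transferred to all t. *)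
Lemma dominated_cvg p L (a b M : R) : complete_metric T -> a < b ->
  dominated p L `[a, b[ -> (forall t, a <= t < b -> L t <= M) ->
  exists l : T, forall e, 0 < e -> exists2 d, 0 < d &
    forall t, a <= t < b -> b - t < d -> mdist (p t) l < e.
Proof.
move=> cT ab dom LM.
have mono s t : a <= s -> s <= t -> t < b -> L s <= L t.
  move=> as_ st tb; rewrite -subr_ge0; apply: le_trans (mdist_ge0 (p s) (p t)) _.
  by apply: dom => //=; rewrite in_itv/=; apply/andP; split; lra.
pose S := L @` `[a, b[.
have hS : has_sup S.
  split; first by exists (L a), a => //=; rewrite in_itv/= lexx ab.
  by exists M => y [t /=]; rewrite in_itv/= => tab <-; exact: LM.
have cau e : 0 < e -> exists2 t0, a <= t0 < b &
    forall s t, t0 <= s < b -> t0 <= t < b -> mdist (p s) (p t) < e.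
  move=> e0; have [_ [t0 /= + <-] Lt0] := sup_adherent e0 hS.
  rewrite in_itv/= => t0ab; exists t0 => // s t.
  have up u : a <= u < b -> L u <= sup S.
    by move=> uab; apply: ub_le_sup; [case: hS|exists u => //=; rewrite in_itv].
  wlog st : s t / s <= t.
    move=> H hs ht; have [st|ts] := leP s t; first exact: H.
    by rewrite metric_sym; apply: H => //; exact: ltW.
  move=> /andP[t0s sb] /andP[t0t tb]; have /andP[at0 _] := t0ab.
  have /up hup : a <= t < b by rewrite tb andbT; lra.
  apply: (@le_lt_trans _ _ (L t - L s)).
    by apply: dom => //=; rewrite in_itv/=; apply/andP; split; lra.
  have := mono _ _ at0 t0s sb; lra.
pose u n := b - (b - a) / n.+1%:R.
have ba0 : 0 < b - a by rewrite subr_gt0.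
have uab n : a <= u n < b.
  rewrite /u ltrBlDr ltrDl divr_gt0// andbT lerBrDr -lerBrDl ler_pdivrMr//.
  by rewrite ler_peMr ?ler1n ?ltW.
have ub d : 0 < d -> exists N, forall n, (N <= n)%N -> b - d <= u n.
  move=> d0; exists (Num.truncn ((b - a) / d)).+1 => n Nn.
  rewrite /u lerD2l lerN2 ler_pdivrMr// mulrC -ler_pdivrMr//.
  apply/ltW; apply: lt_le_trans (truncnS_gt _) _; rewrite ler_nat.
  exact: leqW.
have [e e0|l ul] := cT (p \o u).
  have [t0 /andP[at0 t0b] H] := cau _ e0.
  have [|N HN] := ub (b - t0); first by rewrite subr_gt0.
  exists N => m n /HN um /HN un /=; apply: H; have := uab m; have := uab n.
    by move=> _ /andP[_ ->]; rewrite andbT; lra.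
  by move=> /andP[_ ->] _; rewrite andbT; lra.
exists l => e e0.
have e2 : 0 < e / 2 by rewrite divr_gt0.
have [t0 /andP[at0 t0b] H] := cau _ e2.
exists (b - t0); first by rewrite subr_gt0.
move=> t /andP[at_ tb] ht.
have [|N HN] := ub (b - t0); first by rewrite subr_gt0.
have /cvg_mdistP/(_ _ e2)[N' HN'] := ul.
pose n := maxn N N'.
have h1 := HN' n (leq_maxr _ _); have h2 := HN n (leq_maxl _ _).
have h3 : mdist (p t) (p (u n)) < e / 2.
  apply: H; first by rewrite tb andbT; lra.
  by case/andP: (uab n) => _ ->; rewrite andbT; lra.
by have := metric_triangle (p t) (p (u n)) l; rewrite /= in h1; lra.
Qed.

End Length.

(** * The mean value inequality for the lower scalar derivative *)

Section MeanValue.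
Context {R : realType}.

Lemma within_continuous_realP (T : topologicalType) (A : set R) (q : R -> T) :
  {within A, continuous q} <-> forall t, A t -> forall N, nbhs (q t) N ->
    exists2 d, 0 < d & forall s, A s -> `|s - t| < d -> N (q s).
Proof.
rewrite subspace_continuousP; split=> H t At N qN.
  have [d d0 dN] := (nbhs_realP _ _).1 (H t At N qN).
  by exists d => // s As st; exact: dN.
have [d d0 dN] := H t At N qN.
by apply/nbhs_realP; exists d => // s st As; exact: dN.
Qed.

Context {X Y : metricType R}.
Implicit Types (f : X -> Y).

(** A lower limit above [c] keeps the ratio above [c] on a whole ball; the strict inequality between
    [c] and [alpha] pays for this passage. *)
Lemma Dminus_expanding f (x : X) (c alpha : R) :
  c < alpha -> (alpha%:E <= Dminus f x)%E ->
  exists2 r, 0 < r & forall z, mdist z x < r -> c * mdist z x <= mdist (f z) (f x).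
Proof.
move=> ca aD; have : (c%:E < Dminus f x)%E by rewrite (lt_le_trans _ aD)// lte_fin.
move=> /ereal_sup_gt[_ [r /= r0 <-] cr]; exists r => // z zr.
have [->|zx] := eqVneq z x; first by rewrite !mdistxx mulr0.
have zx0 : 0 < mdist z x by rewrite mdist_gt0.
rewrite -ler_pdivlMr// -lee_fin; apply: le_trans (ltW cr) _.
by apply: ereal_inf_lbound; exists z => //; split=> //=; rewrite zx0 zr.
Qed.

Lemma Dminus_in_open f (V : set X) (x : X) :
  open V -> V x -> (Dminus_in V f x <= Dminus f x)%E.
Proof.
move=> oV Vx; apply: ge_ereal_sup => _ [r /= r0 <-].
have [d d0 dV] := (nbhs_mdistP _ _).1 (open_nbhs_nbhs (conj oV Vx)).
apply: ereal_sup_ge; exists (ereal_inf (dratio f x @` punct_ball setT x (Num.min r d))).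
  by exists (Num.min r d) => //=; rewrite lt_min r0 d0.
apply: le_ereal_inf => _ [z [_ /andP[z0 zr]] <-]; exists z => //.
by move: zr; rewrite lt_min => /andP[zr zd]; split; [exact: dV|rewrite z0 zr].
Qed.

(** Near each t, [f] expands distances to q t by [c], so the increment of [q] between t and a nearby
    s is at most that of [L] divided by [c]. The expansion is only known for pairs containing t,
    which is the form of locality in [real_induction]; the triangle inequality chains the
    increments. *)
Lemma mean_value f (q : R -> X) (L : R -> R) (A : set R) (c alpha : R) :
  0 < c < alpha -> (forall s t u, A s -> A u -> s <= t <= u -> A t) ->
  {within A, continuous q} -> (forall t, A t -> (alpha%:E <= Dminus f (q t))%E) ->
  dominated (f \o q) L A -> dominated q (fun t => L t / c) A.
Proof.
move=> /andP[c0 ca] cA /within_continuous_realP cq aD dom a b Aa Ab ab.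
apply: (real_induction (Q := fun s t => mdist (q s) (q t) <= L t / c - L s / c)) ab _ _.
  move=> t /andP[at_ tb]; have At : A t by apply: (cA a t b) => //; rewrite at_ tb.
  have [r r0 Hr] := Dminus_expanding ca (aD t At).
  have nr : nbhs (q t) [set z | mdist z (q t) < r] by apply/nbhs_mdistP; exists r.
  have [d d0 Hd] := cq t At _ nr.
  have key s : A s -> `|s - t| < d -> mdist (q s) (q t) <= mdist (f (q s)) (f (q t)) / c.
    by move=> As st; rewrite ler_pdivlMr// mulrC; apply: Hr; exact: Hd.
  exists d => //; split=> s /andP[as_ st] sd.
    have As : A s by apply: (cA a s t) => //; rewrite as_ st.
    rewrite -mulrBl; apply: le_trans (key s As _) _; first by rewrite ltr_norml; lra.
    by rewrite ler_pM2r ?invr_gt0//; apply: dom.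
  have As : A s by apply: (cA t s b) => //; rewrite as_ st.
  rewrite -mulrBl metric_sym; apply: le_trans (key s As _) _.
    by rewrite ltr_norml; lra.
  by rewrite ler_pM2r ?invr_gt0// metric_sym; apply: dom.
move=> s t u h1 h2; have := metric_triangle (q s) (q t) (q u); lra.
Qed.

End MeanValue.

(** * Local sections, and uniqueness of lifts *)

Section LocalSection.
Context {R : realType} {X Y : metricType R}.
Implicit Types (f : X -> Y).

(** Since [W] is open, continuity of the inverse is asked at points of Y rather than in the subspace
    [W]. *)
Definition local_section f (V : set X) (W : set Y) (s : Y -> X) :=
  [/\ open V, open W, (forall x, V x -> W (f x) /\ s (f x) = x),
      (forall y, W y -> V (s y) /\ f (s y) = y) &
      forall y, W y -> {for y, continuous s}].

Definition local_homeo f :=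
  continuous f /\ forall x, exists V W s, V x /\ local_section f V W s.

Lemma within_open_continuous_at (S T : topologicalType) (f : S -> T) (V : set S) (x : S) :
  open V -> V x -> {within V, continuous f} -> {for x, continuous f}.
Proof.
move=> oV Vx; rewrite subspace_continuousP => /(_ x Vx) cf.
apply/continuous_atP => N /cf wN; have nV := open_nbhs_nbhs (conj oV Vx).
by apply: filterS (filterI nV wN) => z [Vz]; exact.
Qed.

Lemma homeo_on_section f V W : open V -> open W -> homeo_on f V W ->
  (forall x, V x -> {for x, continuous f}) /\ exists s, local_section f V W s.
Proof.
move=> oV oW [fV cf [g [gW gf fg cg]]]; split.
  by move=> x Vx; exact: within_open_continuous_at cf.
exists g; split=> //.
- by move=> x Vx; split; [rewrite -fV; exists x|exact: gf].
- by move=> y Wy; split; [rewrite -gW; exists y|exact: fg].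
- by move=> y Wy; exact: within_open_continuous_at cg.
Qed.

Lemma local_quasi_isometry_homeo f : local_quasi_isometry f -> local_homeo f.
Proof.
move=> lf; split=> x; have [V [W [oV Vx oW Wfx [hVW _]]]] := lf x.
  by have [cf _] := homeo_on_section oV oW hVW; exact: cf.
by have [_ [s hs]] := homeo_on_section oV oW hVW; exists V, W, s.
Qed.

Lemma local_quasi_isometry_Dminus f (x : X) : local_quasi_isometry f ->
  exists2 alpha, 0 < alpha & \forall z \near x, (alpha%:E <= Dminus f z)%E.
Proof.
move=> lf; have [V [W [oV Vx oW Wfx [_ [alpha [beta [a0 _ H]]]]]]] := lf x.
exists alpha => //; apply: filterS (open_nbhs_nbhs (conj oV Vx)) => z Vz.
by have [h _] := H z Vz; exact: le_trans h (Dminus_in_open f oV Vz).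
Qed.

(** Near each point every small enough positive number is a lower bound. Compactness in
    near-covering form, with the bound as a parameter tending to 0 from the right, makes the choice
    uniform. *)
Lemma compact_Dminus f (K : set X) : local_quasi_isometry f -> compact K ->
  exists2 alpha : R, 0 < alpha & forall x, K x -> (alpha%:E <= Dminus f x)%E.
Proof.
move=> lf /compact_near_coveringP cK.
have [|d /= d0 H] := cK R (0^'+) (fun a x => (a%:E <= Dminus f x)%E) _.
- move=> x Kx; have [alpha a0 Ha] := local_quasi_isometry_Dminus x lf.
  exists ([set z | (alpha%:E <= Dminus f z)%E], [set a | a <= alpha]) => /=.
    split=> //=; exact: nbhs_right_le.
  by move=> [z a] /= [h1 h2]; apply: le_trans h1; rewrite lee_fin.
- by exists (d / 2); [rewrite divr_gt0|apply: H; rewrite /= ?sub0r ?normrN ?gtr0_norm; lra].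
Qed.

Lemma local_section_nbhs f V W s x : local_section f V W s -> V x -> nbhs x V.
Proof. by case=> oV *; exact: open_nbhs_nbhs. Qed.

(** Agreement of the lifts is a locally constant property: near a time of agreement both lie in one
    [V] where [f] is injective, and near a time of disagreement they lie in disjoint balls, of
    radius half the distance of the two values. *)
Lemma unique_lift f (S S' : R -> X) (a b t0 : R) : local_homeo f ->
  (forall t, a <= t <= b -> {for t, continuous S}) ->
  (forall t, a <= t <= b -> {for t, continuous S'}) ->
  (forall t, a <= t <= b -> f (S t) = f (S' t)) ->
  a <= t0 <= b -> S t0 = S' t0 -> forall t, a <= t <= b -> S t = S' t.
Proof.
move=> [cf lf] cS cS' fS abt0 St0.
have loc t : a <= t <= b -> exists2 d, 0 < d & forall u v, a <= u <= b -> a <= v <= b ->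
    `|u - t| < d -> `|v - t| < d -> S u = S' u -> S v = S' v.
  move=> abt; have [St|St] := pselect (S t = S' t).
    have [V [W [s [Vt hs]]]] := lf (S t); have [oV oW Vs Ws cs] := hs.
    have nV := local_section_nbhs hs Vt.
    have nV' : nbhs (S' t) V by rewrite -St.
    have /nbhs_realP[d d0 H] : nbhs t (S @^-1` V `&` S' @^-1` V).
      by apply: filterI; [exact: cS|exact: cS'].
    exists d => // u v abu abv ut /H[/= h1 h2] _.
    by have [_ <-] := Vs _ h1; have [_ <-] := Vs _ h2; rewrite fS.
  have D0 : 0 < mdist (S t) (S' t) / 2 by rewrite divr_gt0// mdist_gt0; apply/eqP.
  have n1 : nbhs (S t) [set z | mdist z (S t) < mdist (S t) (S' t) / 2].
    by apply/nbhs_mdistP; eexists; first exact: D0.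
  have n2 : nbhs (S' t) [set z | mdist z (S' t) < mdist (S t) (S' t) / 2].
    by apply/nbhs_mdistP; eexists; first exact: D0.
  have /nbhs_realP[d d0 H] : nbhs t
      (S @^-1` [set z | mdist z (S t) < mdist (S t) (S' t) / 2] `&`
       S' @^-1` [set z | mdist z (S' t) < mdist (S t) (S' t) / 2]).
    by apply: filterI; [exact: cS|exact: cS'].
  exists d => // u v abu abv /H[/= h1 h2] _ Su.
  rewrite -Su in h2; have := metric_triangle (S t) (S u) (S' t).
  by rewrite [mdist (S t) (S u)]metric_sym => ?; exfalso; lra.
move=> t abt; exact: (interval_induction loc abt0 abt St0).
Qed.

End LocalSection.

(** * Continuity at a point, and extension of paths to the whole line *)

Section ContinuityAt.

Lemma near_eq_continuous (S T : topologicalType) (q q' : S -> T) (s : S) :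
  (\forall v \near s, q v = q' v) -> {for s, continuous q'} -> {for s, continuous q}.
Proof.
move=> qq' /continuous_atP cq; apply/continuous_atP => N.
rewrite (nbhs_singleton qq') => /cq nN.
by apply: filterS (filterI qq' nN) => v [/= ->].
Qed.

Lemma within_continuous_comp (S T U : topologicalType) (A : set T) (p : T -> U)
    (g : S -> T) (s : S) : {within A, continuous p} ->
  (\forall z \near s, A (g z)) -> {for s, continuous g} -> {for s, continuous (p \o g)}.
Proof.
rewrite subspace_continuousP => cp Ag /continuous_atP cg; apply/continuous_atP => N.
move=> /(cp _ (nbhs_singleton Ag)) /cg nN.
by apply: filterS (filterI Ag nN) => v [/= h]; exact.
Qed.

Lemma continuous_at_comp (S T U : topologicalType) (p : T -> U) (g : S -> T) (s : S) :
  {for g s, continuous p} -> {for s, continuous g} -> {for s, continuous (p \o g)}.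
Proof. by move=> cp cg; apply: continuous_comp. Qed.

Lemma continuous_at_pair (S T U : topologicalType) (g : S -> T) (h : S -> U) (s : S) :
  {for s, continuous g} -> {for s, continuous h} ->
  {for s, continuous (fun z => (g z, h z))}.
Proof. by move=> cg ch; apply: cvg_pair. Qed.

Context {R : realType}.

Definition clamp (t : R) := Num.max 0 (Num.min t 1).

Lemma clamp01 t : 0 <= clamp t <= 1.
Proof. by rewrite /clamp le_max lexx ge_max ler01 ge_min lexx orbT. Qed.

Lemma clamp_id t : 0 <= t <= 1 -> clamp t = t.
Proof. by move=> /andP[t0 t1]; rewrite /clamp (min_idPl t1) (max_idPr t0). Qed.

Lemma clamp_le0 t : t <= 0 -> clamp t = 0.
Proof. by move=> t0; rewrite /clamp (max_idPl _)// ge_min t0. Qed.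

Lemma clamp_ge1 t : 1 <= t -> clamp t = 1.
Proof. by move=> t0; rewrite /clamp (min_idPr t0) (max_idPr _). Qed.

Lemma clampK t : clamp (clamp t) = clamp t.
Proof. exact: clamp_id (clamp01 t). Qed.

Lemma clamp_rev t : clamp (-1 * t + 1) = -1 * clamp t + 1.
Proof.
have [t0|t0] := leP t 0; first by rewrite (clamp_le0 t0) clamp_ge1; lra.
have [t1|t1] := leP 1 t; first by rewrite (clamp_ge1 t1) clamp_le0; lra.
by rewrite !clamp_id//; apply/andP; split; lra.
Qed.

Lemma continuous_lipschitz1 (g : R -> R) :
  (forall s t, `|g s - g t| <= `|s - t|) -> continuous g.
Proof.
move=> Hg t; apply/continuous_atP => N /nbhs_realP[d d0 dN].
by apply/nbhs_realP; exists d => // s st; apply: dN; apply: le_lt_trans (Hg _ _) st.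
Qed.

Lemma max_continuous (a : R) : continuous (fun t => Num.max a t).
Proof.
apply: continuous_lipschitz1 => s t; rewrite ler_norml.
by case: (leP a s) => ?; case: (leP a t) => ?; case: (ger0P (s - t)) => ?; apply/andP; split; lra.
Qed.

Lemma clamp_continuous : continuous clamp.
Proof.
apply: continuous_lipschitz1 => s t; rewrite /clamp ler_norml.
by case: (leP s 1) => ?; case: (leP t 1) => ?; case: (leP 0 s) => ?;
  case: (leP 0 t) => ?; rewrite ?(max_idPr ler01); case: (ger0P (s - t)) => ?; apply/andP; split; lra.
Qed.

Lemma clamp_path_continuous (T : topologicalType) (p : R -> T) :
  {within `[0, 1], continuous p} -> continuous (p \o clamp).
Proof.
move=> cp t; apply: (within_continuous_comp (g := clamp) cp); last exact: clamp_continuous.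
by exists 1 => //= z _; rewrite in_itv /= clamp01.
Qed.

Lemma half_open_continuous (T : topologicalType) (b : R) (q : R -> T) : 0 < b ->
  {within `[0, b[, continuous q} ->
  forall t, t < b -> {for t, continuous (q \o Num.max (0 : R))}.
Proof.
move=> b0 cq t tb; apply: (within_continuous_comp (g := Num.max (0 : R)) cq); last exact: max_continuous.
apply: filterS (lt_nbhsl tb) => z zb /=.
by rewrite in_itv/= le_max lexx gt_max b0 zb.
Qed.

End ContinuityAt.

(** * Lifting paths and homotopies *)

Section Lifting.
Context {R : realType} {X Y : metricType R} {f : X -> Y} (hf : local_homeo f).

(* A lift on ]-oo, b[ that accumulates at [x] when its parameter tends to b is
   eventually given by a local section of [f] at [x]. *)
Lemma lift_accumulation (p : R -> Y) (q : R -> X) (a b : R) (x : X) : a < b ->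
  continuous p -> (forall t, t < b -> {for t, continuous q}) ->
  (forall t, a < t < b -> f (q t) = p t) ->
  (forall N, nbhs x N -> forall e, 0 < e -> exists2 t, b - e < t < b & N (q t)) ->
  exists V W s d, [/\ V x, local_section f V W s, 0 < d,
    forall t, `|t - b| < d -> W (p t) & forall t, b - d < t < b -> q t = s (p t)].
Proof.
move=> ab cp cq fq acc; have [cf lf] := hf.
have [V [W [s [Vx hs]]]] := lf x; have [oV oW Vs Ws cs] := hs.
(* Otherwise some t close to [b] has f (q t) close to f x and p t close to p b, although f (q t) = p
   t. *)
have fx : f x = p b.
  apply: contrapT => /eqP; rewrite -mdist_gt0 => D0.
  have e0 : 0 < mdist (f x) (p b) / 2 by rewrite divr_gt0.
  have n1 : nbhs (f x) [set z | mdist z (f x) < mdist (f x) (p b) / 2].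
    by apply/nbhs_mdistP; eexists; first exact: e0.
  have n2 : nbhs (p b) [set z | mdist z (p b) < mdist (f x) (p b) / 2].
    by apply/nbhs_mdistP; eexists; first exact: e0.
  have /nbhs_realP[d d0 Hd] := cp b _ n2.
  have e0' : 0 < Num.min d (b - a) by rewrite lt_min d0 subr_gt0.
  have [t /andP[dt tb] /= ht] := acc _ (cf x _ n1) _ e0'.
  have md : Num.min d (b - a) <= d by rewrite ge_min lexx.
  have ma : Num.min d (b - a) <= b - a by rewrite ge_min lexx orbT.
  have : mdist (p t) (p b) < mdist (f x) (p b) / 2.
    by apply: Hd; rewrite ltr_norml; apply/andP; split; lra.
  rewrite -fq; last by apply/andP; split; lra.
  have := metric_triangle (f x) (f (q t)) (p b).
  by rewrite [mdist (f x) (f (q t))]metric_sym; lra.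
have Wb : W (p b) by rewrite -fx; case: (Vs _ Vx).
have /nbhs_realP[d1 d10 Hd] := cp b _ (open_nbhs_nbhs (conj oW Wb)).
pose d := Num.min d1 (b - a).
have d0 : 0 < d by rewrite lt_min d10 subr_gt0.
have dd1 : d <= d1 by rewrite ge_min lexx.
have dba : d <= b - a by rewrite ge_min lexx orbT.
exists V, W, s, d; split=> //; first by move=> t td; apply: Hd; lra.
(* One time at which [q] visits [V] is enough: [q] and s \o p agree there, and uniqueness of lifts
   extends this to the whole of ]b - d, b[. *)
have [t0 /andP[dt0 t0b] Vt0] := acc _ (open_nbhs_nbhs (conj oV Vx)) _ d0.
move=> t /andP[dt tb].
have Wp u : Num.min t t0 <= u <= Num.max t t0 -> W (p u).
  rewrite ge_min le_max => /andP[h1 h2]; apply: Hd.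
  by rewrite ltr_norml; apply/andP; split; [case/orP: h1|case/orP: h2] => ?; lra.
have inab u : Num.min t t0 <= u <= Num.max t t0 -> a < u < b.
  rewrite ge_min le_max => /andP[h1 h2].
  by apply/andP; split; [case/orP: h1|case/orP: h2] => ?; lra.
apply: (unique_lift hf (S := q) (S' := s \o p)
  (a := Num.min t t0) (b := Num.max t t0) (t0 := t0)).
- by move=> u /inab/andP[_ ?]; exact: cq.
- move=> u /Wp Wu; apply: continuous_at_comp; last exact: cp.
  exact: cs.
- by move=> u hu; rewrite fq ?inab//; case: (Ws _ (Wp _ hu)).
- by rewrite ge_min le_max lexx !orbT.
- rewrite /=; have <- : f (q t0) = p t0 by apply: fq; apply/andP; split; lra.
  by case: (Vs _ Vt0).
- by rewrite ge_min le_max lexx.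
Qed.

(** The half-line is open, so no relative continuity is involved; when 0 < b the value at 0
    determines the lift. *)
Definition lifts_below (p : R -> Y) (x : X) (b : R) (q : R -> X) :=
  [/\ forall t, t < b -> {for t, continuous q}, forall t, t < b -> f (q t) = p t &
      q 0 = x].

(* The total form of the continuation property: [p] is meant to be constant
   outside [0,1]. *)
Definition continues (p : R -> Y) := forall (b : R) (q : R -> X), 0 < b <= 1 ->
  (forall t, t < b -> {for t, continuous q}) -> (forall t, t < b -> f (q t) = p t) ->
  exists x : X, forall N, nbhs x N -> forall e, 0 < e -> exists2 t, b - e < t < b & N (q t).

Lemma lifts_below_unique p x b b' q q' : 0 < b -> 0 < b' ->
  lifts_below p x b q -> lifts_below p x b' q' ->
  forall t, t < b -> t < b' -> q t = q' t.
Proof.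
move=> b0 b0' [cq fq q0] [cq' fq' q0'] t tb tb'.
have lt u : Num.min t 0 <= u <= Num.max t 0 -> u < b /\ u < b'.
  by rewrite le_max => /andP[_ /orP[]] h; split; lra.
apply: (unique_lift hf (a := Num.min t 0) (b := Num.max t 0) (t0 := 0)).
- by move=> u /lt[]; auto.
- by move=> u /lt[]; auto.
- by move=> u /lt[? ?]; rewrite fq ?fq'.
- by rewrite ge_min le_max lexx !orbT.
- by rewrite q0 q0'.
- by rewrite ge_min le_max lexx.
Qed.

Lemma lifts_below_limit p x b : 0 < b ->
  (forall s, 0 < s < b -> exists q, lifts_below p x s q) ->
  exists q, lifts_below p x b q.
Proof.
move=> b0 H.
have [|Q HQ] := @choice R (R -> X) (fun s q => 0 < s < b -> lifts_below p x s q).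
  move=> s; have [sb|sb] := pselect (0 < s < b); last by exists (fun=> x).
  by have [q hq] := H s sb; exists q.
(* At time u the glued lift uses the lift below g u, a point strictly between u and b; by uniqueness
   the choice of such a point does not affect the value. *)
pose g (u : R) := (Num.max 0 u + b) / 2.
have gP u : u < b -> 0 < g u < b /\ u < g u.
  by rewrite /g; case: (leP 0 u) => ? ?; split; try (apply/andP; split); lra.
have Qe u v : u < b -> v < b -> v < g u -> Q (g v) v = Q (g u) v.
  move=> /gP[gu _] /gP[gv vg] vu.
  by apply: (lifts_below_unique _ _ (HQ _ gv) (HQ _ gu)) => //;
    [case/andP: gv|case/andP: gu].
exists (fun u => Q (g u) u); split.
- move=> t tb; have [gt tg] := gP t tb; have [cq _ _] := HQ _ gt.
  apply: (near_eq_continuous (q' := Q (g t))); last exact: cq.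
  by apply: filterS (filterI (lt_nbhsl tb) (lt_nbhsl tg)) => v [vb vt]; exact: Qe.
- by move=> t tb; have [gt tg] := gP t tb; have [_ fq _] := HQ _ gt; exact: fq.
- by have [g0 _] := gP 0 b0; have [_ _ ->] := HQ _ g0.
Qed.

(** From [b] on, the lift continues as s \o p for the local section at the accumulation point, with
    which it already agrees just before [b]. *)
Lemma lifts_below_extend p x b : continuous p -> continues p -> 0 < b <= 1 ->
  (exists q, lifts_below p x b q) ->
  exists2 d, 0 < d & exists q, lifts_below p x (b + d) q.
Proof.
move=> cp cont b01 [q hq]; have [cq fq q0] := hq.
have [x' acc] := cont b q b01 cq fq; have /andP[b0 _] := b01.
have [|V [W [s [d [Vx hs d0 Wp qs]]]]] := lift_accumulation b0 cp cq _ acc.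
  by move=> t /andP[_ tb]; exact: fq.
have [oV oW Vs Ws cs] := hs.
exists d => //; exists (fun t => if t < b then q t else s (p t)); split.
- move=> t tbd; have [tb|bt] := ltP t b.
    apply: (near_eq_continuous (q' := q)); last exact: cq.
    by apply: filterS (lt_nbhsl tb) => v ->.
  apply: (near_eq_continuous (q' := s \o p)).
    have bdt : b - d < t by lra.
    apply: filterS (lt_nbhsr bdt) => v bdv; case: ifP => // vb.
    by rewrite qs ?bdv.
  apply: continuous_at_comp (cp t); apply: cs; apply: Wp.
  by rewrite ltr_norml; apply/andP; split; lra.
- move=> t tbd; case: ltP => [tb|bt]; first exact: fq.
  by have [] // := Ws (p t); apply: Wp; rewrite ltr_norml; apply/andP; split; lra.
- by rewrite b0.
Qed.

Lemma path_lift p x : continuous p -> (forall t, p (clamp t) = p t) ->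
  continues p -> f x = p 0 ->
  exists q, [/\ continuous q, forall t, f (q t) = p t & q 0 = x].
Proof.
move=> cp pc cont fx; have [cf lf] := hf.
pose G b := exists q, lifts_below p x b q.
have Gle s t : s <= t -> G t -> G s.
  move=> st [q [cq fq q0]]; exists q; split=> // u us; [apply: cq|apply: fq]; lra.
(* A local section at [x] lifts [p] on all of ]-oo, d[, because [p] is constant on negative
   times. *)
have [d d01 Gd] : exists2 d, 0 < d <= 1 & G d.
  have [V [W [s [Vx [oV oW Vs Ws cs]]]]] := lf x.
  have W0 : W (p 0) by rewrite -fx; case: (Vs _ Vx).
  have /nbhs_realP[d1 d10 Hd] := cp 0 _ (open_nbhs_nbhs (conj oW W0)).
  exists (Num.min d1 1); first by rewrite lt_min d10 ltr01 ge_min lexx orbT.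
  have Wp t : t < Num.min d1 1 -> W (p t).
    rewrite lt_min => /andP[td t1]; have [t0|t0] := leP t 0.
      by rewrite -pc clamp_le0.
    by apply: Hd; rewrite subr0 gtr0_norm.
  exists (s \o p); split.
  - by move=> t /Wp Wt; apply: continuous_at_comp (cp t); exact: cs.
  - by move=> t /Wp Wt; case: (Ws _ Wt).
  - by rewrite /= -fx; case: (Vs _ Vx).
have /andP[d0 d1] := d01.
have G1 : G 1.
  apply: (real_induction (Q := fun s t => G s -> G t) d1 _ _) Gd; last by auto.
  move=> t /andP[dt t1].
  (* Either lifts exist below every s < t and they glue, or one s0 < t has none; then, [G] being
     downward closed, it fails for all s close to t and the implication is vacuous. *)
  have [dl dl0 Hl] : exists2 dl, 0 < dl & forall s, d <= s <= t -> t - s < dl -> G s -> G t.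
    have [H|] := pselect (forall s, 0 < s < t -> G s).
      by exists 1 => // s _ _ _; apply: lifts_below_limit H; lra.
    move=> /existsNP[s0 /not_implyP[/andP[_ s0t] nG]].
    exists (t - s0); first by rewrite subr_gt0.
    by move=> s _ ts Gs; exfalso; apply: nG; apply: Gle Gs; lra.
  have [Gt|nGt] := pselect (G t); last by exists dl => //; split.
  have [|e e0 Ge] := lifts_below_extend cp cont _ Gt; first by rewrite t1; lra.
  exists (Num.min dl e); first by rewrite lt_min dl0 e0.
  split=> s /andP[h1 h2]; rewrite lt_min => /andP[h3 h4] _ //.
  by apply: Gle Ge; lra.
(* G 1 leaves out the time 1 itself; one more extension covers it, after which q \o clamp is defined
   and continuous everywhere. *)
have [|e e0 [q [cq fq q0]]] := lifts_below_extend cp cont _ G1; first by rewrite ltr01 lexx.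
have ce t : clamp t < 1 + e by have /andP[_ h] := clamp01 t; lra.
exists (q \o clamp); split.
- by move=> t; apply: continuous_at_comp (@clamp_continuous _ t); apply: cq.
- by move=> t /=; rewrite fq.
- by rewrite /= clamp_id// lexx ler01.
Qed.

Lemma lift_unique (q q' : R -> X) : continuous q -> continuous q' ->
  (forall t, f (q t) = f (q' t)) -> forall t0, q t0 = q' t0 -> q = q'.
Proof.
move=> cq cq' fq t0 qt0; apply/funext => t.
apply: (unique_lift hf (a := Num.min t t0) (b := Num.max t t0) (t0 := t0)) => //.
- by move=> u _; exact: cq.
- by move=> u _; exact: cq'.
- by rewrite ge_min le_max lexx !orbT.
- by rewrite ge_min le_max lexx.
Qed.

(** As soon as one time slice of [F] near t0 is continuous at y1, that slice stays in the domain of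
    a local section s for y near y1, and uniqueness of lifts forces F = s \o H around (y1, t0). All
    slices near t0 are then continuous at y1, so continuity spreads from the slice at time 0. *)
Lemma homotopy_lift (T : topologicalType) (U : set T) (H : T * R -> Y) (F : T * R -> X) :
  open U -> (forall y t, U y -> {for (y, t), continuous H}) ->
  (forall y t, U y -> f (F (y, t)) = H (y, t)) ->
  (forall y, U y -> continuous (fun t => F (y, t))) ->
  (forall y, U y -> {for y, continuous (fun y => F (y, 0))}) ->
  forall y t, U y -> {for (y, t), continuous F}.
Proof.
move=> oU cH fF cF c0 y1 t1 Uy1; have [cf lf] := hf.
pose G t := {for y1, continuous (fun y => F (y, t))}.
have nU := open_nbhs_nbhs (conj oU Uy1).
have key t0 : exists2 d, 0 < d & forall u v, `|u - t0| < d -> `|v - t0| < d ->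
    G u -> {for (y1, v), continuous F}.
  have [V [W [s [Vx hs]]]] := lf (F (y1, t0)); have [oV oW Vs Ws cs] := hs.
  have W0 : W (H (y1, t0)) by rewrite -fF//; case: (Vs _ Vx).
  have /= [[N B] /= [nN nB] NB] := cH y1 t0 Uy1 _ (open_nbhs_nbhs (conj oW W0)).
  have nV := cF y1 Uy1 t0 _ (open_nbhs_nbhs (conj oV Vx)).
  have /nbhs_realP[d d0 Hd] : nbhs t0 (B `&` (fun t => V (F (y1, t)))) by exact: filterI.
  exists d => // u v ut vt Gu.
  have Vu : V (F (y1, u)) by have [] := Hd u ut.
  have nVu := Gu _ (open_nbhs_nbhs (conj oV Vu)).
  have nN' : nbhs y1 (N `&` (U `&` (fun y => V (F (y, u))))).
    by apply: filterI => //; exact: filterI.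
  have FsH y w : (N `&` (U `&` (fun y => V (F (y, u))))) y -> `|w - t0| < d ->
      F (y, w) = s (H (y, w)).
    move=> [Ny [Uy Vy]] wt.
    have Wr r : Num.min w u <= r <= Num.max w u -> W (H (y, r)).
      rewrite ge_min le_max => /andP[h1 h2]; apply: (NB (y, r)); split=> //=.
      have [] // := Hd r; move: ut wt; rewrite !ltr_norml => /andP[? ?] /andP[? ?].
      by apply/andP; split; [case/orP: h1|case/orP: h2] => ?; lra.
    apply: (unique_lift hf (S := fun w => F (y, w)) (S' := fun w => s (H (y, w)))
        (a := Num.min w u) (b := Num.max w u) (t0 := u)).
    - by move=> r _; exact: cF.
    - move=> r /Wr Wyr; apply: (continuous_at_comp (g := fun r => H (y, r))); first exact: cs.
      apply: (continuous_at_comp (g := fun r => (y, r))); first exact: cH.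
      apply: continuous_at_pair; [exact: cst_continuous|exact: cvg_id].
    - by move=> r hr; rewrite fF//; case: (Ws _ (Wr _ hr)).
    - by rewrite ge_min le_max lexx !orbT.
    - by rewrite -fF//; case: (Vs _ Vy).
    - by rewrite ge_min le_max lexx.
  apply: (near_eq_continuous (q' := s \o H)); last first.
    apply: continuous_at_comp (cH _ _ Uy1); apply: cs; apply: NB; split=> /=.
      exact: nbhs_singleton nN.
    by have [] := Hd v vt.
  exists (N `&` (U `&` (fun y => V (F (y, u)))), [set w | `|w - t0| < d]) => /=.
    split=> //; apply/nbhs_realP; exists (d - `|v - t0|); first by rewrite subr_gt0.
    move=> w wv /=; have := ler_normD (w - v) (v - t0).
    by rewrite addrA subrK; lra.
  by move=> [y w] [/= h1 h2]; exact: FsH.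
have slice v : {for (y1, v), continuous F} -> G v.
  move=> cFv; apply: (continuous_at_comp (g := fun y => (y, v))); first exact: cFv.
  apply: continuous_at_pair; [exact: cvg_id|exact: cst_continuous].
have Gall : G t1.
  apply: (interval_induction (P := G) (a := Num.min 0 t1) (b := Num.max 0 t1) _ _ _ (c0 _ Uy1)).
  - move=> t _; have [d d0 Hd] := key t; exists d => // u v _ _ hu hv Gu.
    by apply: slice; exact: Hd Gu.
  - by rewrite ge_min le_max lexx.
  - by rewrite ge_min le_max lexx !orbT.
have [d d0 Hd] := key t1; apply: (Hd t1 t1) => //; by rewrite subrr normr0.
Qed.

End Lifting.

(** * Continuation, finite length and bounded lifting *)

Section Continuation.
Context {R : realType} {X Y : metricType R} {f : X -> Y}.

Lemma lift_on_lifts_below (p : R -> Y) (b : R) (q : R -> X) : 0 < b <= 1 ->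
  lift_on f p b q -> lifts_below (f := f) (p \o clamp) (q 0) b (q \o Num.max (0 : R)).
Proof.
move=> /andP[b0 b1] [cq fq]; split; last by rewrite /= maxxx.
  exact: half_open_continuous.
move=> t tb /=; rewrite fq ?le_max ?lexx ?gt_max ?b0 ?tb//.
rewrite /clamp; congr (p (Num.max _ _)).
by rewrite (min_idPl _)//; lra.
Qed.

Lemma lifts_below_lift_on (p : R -> Y) (b : R) (x : X) (q : R -> X) : b <= 1 ->
  lifts_below (f := f) (p \o clamp) x b q -> lift_on f p b q.
Proof.
move=> b1 [cq fq _]; split.
  by apply: continuous_in_subspaceT => t; rewrite inE/= in_itv/= => /andP[_]; exact: cq.
by move=> t /andP[t0 tb]; rewrite fq//= clamp_id// t0; lra.
Qed.

Lemma continuation_continues (p : R -> Y) :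
  continuation_property f p -> continues (f := f) (p \o clamp).
Proof.
move=> cont b q b01 cq fq.
have [|t [t0b tb [l ql]]] := cont b q b01.
  by apply: (lifts_below_lift_on (x := q 0)); [case/andP: b01|split].
exists l => N nN e e0.
have [n1 _ H1] := ql _ nN.
have : nbhs b [set z | `|z - b| < e] by apply/nbhs_realP; exists e.
move=> /tb [n2 _ H2]; pose n := maxn n1 n2.
exists (t n); last by apply: H1; rewrite /= leq_maxl.
have /= := H2 n (leq_maxr _ _); have /andP[_ ->] := t0b n.
by rewrite ltr_norml andbT => /andP[h _]; lra.
Qed.

Lemma accumulation_continuation (p : R -> Y) :
  (forall (b : R) (q : R -> X), 0 < b <= 1 -> lift_on f p b q ->
    exists x : X, forall N, nbhs x N -> forall e, 0 < e ->
      exists2 t, 0 <= t < b /\ b - e < t & N (q t)) ->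
  continuation_property f p.
Proof.
move=> H b q b01 ql; have [x acc] := H b q b01 ql.
have h n : exists t, [/\ 0 <= t < b, b - n.+1%:R^-1 < t & mdist (q t) x < n.+1%:R^-1].
  have n0 : (0 : R) < n.+1%:R^-1 by rewrite invr_gt0 ltr0n.
  have nx : nbhs x [set z | mdist z x < n.+1%:R^-1] by apply/nbhs_mdistP; exists n.+1%:R^-1.
  by have [t [tb bt] xt] := acc _ nx _ n0; exists t.
have [t ht] := choice h; exists t.
have small (e : R) : 0 < e -> exists n, forall m, (n <= m)%N -> m.+1%:R^-1 < e.
  move=> e0; exists (Num.truncn e^-1) => m nm.
  rewrite -[e]invrK ltf_pV2 ?posrE ?invr_gt0 ?ltr0n//.
  by apply: lt_le_trans (truncnS_gt _) _; rewrite ler_nat.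
split; first by move=> n; case: (ht n).
  move=> N /nbhs_realP[d d0 dN]; have [n Hn] := small d d0.
  exists n => // m /= /Hn md; apply: dN; have [/andP[_ tb] bt _] := ht m.
  by move: bt md; set w := _^-1 => bt md; rewrite ltr_norml; apply/andP; split; lra.
exists x; apply/cvg_mdistP => e e0; have [n Hn] := small e e0.
by exists n => m /Hn me; have [_ _ h3] := ht m; apply: lt_trans me.
Qed.

Lemma continues_continuation (p : R -> Y) :
  continues (f := f) (p \o clamp) -> continuation_property f p.
Proof.
move=> cont; apply: accumulation_continuation => b q b01 ql.
have [cq fq _] := lift_on_lifts_below b01 ql.
have [x acc] := cont b _ b01 cq fq; exists x => N nN e e0.
have /andP[b0 _] := b01.
have e0' : 0 < Num.min e b by rewrite lt_min e0 b0.
have [t /andP[bt tb]] := acc N nN _ e0'.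
have he : Num.min e b <= e by rewrite ge_min lexx.
have hb : Num.min e b <= b by rewrite ge_min lexx orbT.
have t0 : 0 <= t by lra.
by rewrite /= (max_idPr t0); exists t => //; rewrite t0 tb; split=> //; lra.
Qed.

Lemma limit_continuation (p : R -> Y) :
  (forall (b : R) (q : R -> X), 0 < b <= 1 -> lift_on f p b q ->
    exists x : X, forall e, 0 < e -> exists2 d, 0 < d &
      forall t, 0 <= t < b -> b - t < d -> mdist (q t) x < e) ->
  continuation_property f p.
Proof.
move=> H; apply: accumulation_continuation => b q b01 ql.
have [x lim] := H b q b01 ql; exists x => N /nbhs_mdistP[r r0 rN] e e0.
have [d d0 Hd] := lim r r0; have /andP[b0 _] := b01.
pose m := Num.min (Num.min d e) b.
have m0 : 0 < m by rewrite !lt_min d0 e0 b0.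
have md : m <= d by rewrite /m !ge_min lexx.
have me : m <= e by rewrite /m !ge_min lexx !orbT.
have mb : m <= b by rewrite /m !ge_min lexx !orbT.
have tb : 0 <= b - m / 2 < b by apply/andP; split; lra.
by exists (b - m / 2); [split=> //; lra|apply: rN; apply: Hd => //; lra].
Qed.

Lemma continuation_bounded_lifting (p : R -> Y) : local_quasi_isometry f ->
  is_path01 p -> continuation_property f p -> bounded_path_lifting f p.
Proof.
move=> lf cp cont b q b01 ql.
have hf := local_quasi_isometry_homeo lf.
have hq := lift_on_lifts_below b01 ql; have /andP[b0 b1] := b01.
have [d d0 [q' hq']] := lifts_below_extend hf (clamp_path_continuous cp)
  (continuation_continues cont) b01 (ex_intro _ _ hq).
have bd0 : 0 < b + d by lra.
have [cq' _ _] := hq'.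
have cK : compact (q' @` `[0, b]).
  apply: continuous_compact (@segment_compact _ _ _).
  apply: continuous_in_subspaceT => t; rewrite inE/= in_itv/= => /andP[_ tb].
  by apply: cq'; lra.
have [alpha a0 Ha] := compact_Dminus lf cK; exists alpha; split=> // x [t].
rewrite /= in_itv/= => /andP[t0 tb] <-; apply: Ha.
exists t; first by rewrite /= in_itv/= t0 ltW.
rewrite (lifts_below_unique hf bd0 b0 hq' hq)//=; last by lra.
by rewrite (max_idPr t0).
Qed.

Lemma interval_convex (a b s t u : R) : `[a, b[%classic s -> `[a, b[%classic u ->
  s <= t <= u -> `[a, b[%classic t.
Proof.
rewrite /= !in_itv/= => /andP[? ?] /andP[? ?] /andP[? ?].
by apply/andP; split; lra.
Qed.

(** The factor 2 is the loss between a lower limit and a ball; any positive constant below [alpha]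
    would serve in its place. *)
Lemma bounded_lift_dominated (q : R -> X) (L : R -> R) (a b alpha : R) :
  0 < alpha -> {within `[a, b[, continuous q} ->
  (forall t, a <= t < b -> (alpha%:E <= Dminus f (q t))%E) ->
  dominated (f \o q) L `[a, b[ ->
  dominated q (fun t => L t / (alpha / 2)) `[a, b[.
Proof.
move=> a0 cq aD dom.
apply: (mean_value (f := f) (alpha := alpha)) dom => //.
- by apply/andP; split; lra.
- by move=> s t u; exact: interval_convex.
Qed.

Lemma lift_dominated (p : R -> Y) (q : R -> X) (L : R -> R) (b : R) : b <= 1 ->
  lift_on f p b q -> dominated p L `[0, 1] -> dominated (f \o q) L `[0, b[.
Proof.
move=> b1 [_ fq] dom s t; rewrite /= !in_itv/= => sb tb st.
have /andP[? ?] := sb; have /andP[? ?] := tb.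
by rewrite !fq//; apply: dom => //=; rewrite in_itv/=; apply/andP; split; lra.
Qed.

Lemma dominated_le (T : metricType R) (q : R -> T) L (A : set R) s t :
  dominated q L A -> A s -> A t -> s <= t -> L s <= L t.
Proof.
by move=> dom As At st; rewrite -subr_ge0 (le_trans (mdist_ge0 (q s) (q t)))// dom.
Qed.

Lemma bounded_lifting_continuation (p : R -> Y) : complete_metric X ->
  rectifiable_path01 p -> bounded_path_lifting f p -> continuation_property f p.
Proof.
move=> cX [cp /(path_lengthP _ ler01)[L dom]] bl.
apply: limit_continuation => b q b01 ql; have /andP[b0 b1] := b01.
have [alpha [a0 Ha]] := bl b q b01 ql.
have domq : dominated q (fun t => L t / (alpha / 2)) `[0, b[.
  apply: bounded_lift_dominated => //; first by case: ql.
    by move=> t tb; apply: Ha; exists t => //=; rewrite in_itv.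
  exact: lift_dominated ql dom.
apply: (dominated_cvg (M := L 1 / (alpha / 2)) cX b0 domq) => t /andP[t0 tb].
rewrite ler_pM2r; last by rewrite invr_gt0 divr_gt0.
by apply: (dominated_le dom); rewrite /= ?in_itv/=; try (apply/andP; split); lra.
Qed.

Definition preserves_finite_length := forall (a b : R) (q : R -> X), a < b ->
  {within `[a, b[%classic, continuous q} ->
  (hpath_length (f \o q) a b < +oo)%E -> (hpath_length q a b < +oo)%E.

Lemma finite_length_continuation (p : R -> Y) : complete_metric X ->
  preserves_finite_length -> rectifiable_path01 p -> continuation_property f p.
Proof.
move=> cX c3 [cp /(path_lengthP _ ler01)[L dom]].
apply: limit_continuation => b q b01 ql; have /andP[b0 b1] := b01.
have /hpath_lengthP[L' [M [dom' LM]]] : (hpath_length q 0 b < +oo)%E.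
  apply: c3 => //; first by case: ql.
  apply/hpath_lengthP; exists L, (L 1); split; first exact: lift_dominated ql dom.
  move=> t /andP[t0 tb]; apply: (dominated_le dom);
    by rewrite /= ?in_itv/=; try (apply/andP; split); lra.
exact: dominated_cvg cX b0 dom' LM.
Qed.

(* [f \o q] has a limit at b since Y is complete; reparametrised to [0,1] it
   becomes a rectifiable path of which q is a lift. *)
Lemma bounded_lifting_finite_length : complete_metric Y -> continuous f ->
  (forall p : R -> Y, rectifiable_path01 p -> bounded_path_lifting f p) ->
  preserves_finite_length.
Proof.
move=> cY cf c4 a b q ab cq /hpath_lengthP[L [M [dom LM]]].
have [y lim] := dominated_cvg cY ab dom LM.
pose u (t : R) := a + (b - a) * t.
have ba0 : 0 < b - a by rewrite subr_gt0.
have uab t : 0 <= t < 1 -> a <= u t < b.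
  move=> /andP[t0 t1]; rewrite /u lerDl mulr_ge0 ?(ltW ba0)//=.
  by rewrite -ltrBrDl -[ltRHS]mulr1 ltr_pM2l.
have uS s t : u t - u s = (b - a) * (t - s) by rewrite /u; ring.
have u_le s t : s <= t -> u s <= u t.
  by move=> st; rewrite -subr_ge0 uS mulr_ge0 ?(ltW ba0)// subr_ge0.
(* The triangle inequality through f (q v), for v between t and b and arbitrarily close to b. *)
have Leq t : a <= t < b -> mdist (f (q t)) y <= M - L t.
  move=> tab; have /andP[at_ tb] := tab; apply/ler_addgt0Pr => e e0.
  have [d d0 Hd] := lim e e0.
  pose v := b - Num.min (b - t) d / 2.
  have m0 : 0 < Num.min (b - t) d by rewrite lt_min subr_gt0 tb d0.
  have m1 : Num.min (b - t) d <= b - t by rewrite ge_min lexx.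
  have m2 : Num.min (b - t) d <= d by rewrite ge_min lexx orbT.
  have vab : a <= v < b by rewrite /v; apply/andP; split; lra.
  have tv : t <= v by rewrite /v; lra.
  have vd : b - v < d by rewrite /v; lra.
  have h1 := Hd v vab vd; have h2 := LM v vab.
  have h3 : mdist ((f \o q) t) ((f \o q) v) <= L v - L t by apply: dom; rewrite //= in_itv.
  by have := metric_triangle ((f \o q) t) ((f \o q) v) y => /=; rewrite /= in h1 h3; lra.
pose p (t : R) := if t < 1 then f (q (u t)) else y.
have pP : rectifiable_path01 p.
  split.
    apply/within_continuous_realP => t; rewrite /= in_itv/= => /andP[t0 t1] N.
    move: t1; rewrite le_eqVlt => /orP[/eqP->|t1].
      rewrite /p ltxx => /nbhs_mdistP[e e0 eN]; have [d d0 Hd] := lim e e0.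
      exists (d / (b - a)); first by rewrite divr_gt0.
      move=> s; rewrite /= in_itv/= => /andP[s0 s1] s1d; apply: eN.
      have [s1'|_] := ltP s 1; last by rewrite mdistxx.
      apply: Hd; first by apply: uab; rewrite s0.
      move: s1d; rewrite ltr_pdivlMr// ler0_norm ?subr_le0// /u; lra.
    rewrite /p t1 => nN; have utab : a <= u t < b by apply: uab; rewrite t0.
    have [d d0 Hd] := (within_continuous_realP _ _).1 cq (u t) utab _ (cf _ _ nN).
    have t1' : 0 < 1 - t by rewrite subr_gt0.
    exists (Num.min (d / (b - a)) (1 - t)); first by rewrite lt_min t1' divr_gt0.
    move=> s; rewrite /= in_itv/= lt_min => /andP[s0 s1] /andP[h1 h2].
    have s1' : s < 1 by move: h2; rewrite ltr_norml => /andP[_]; lra.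
    rewrite s1'; apply: Hd; first by rewrite /= in_itv/=; apply: uab; rewrite s0.
    by rewrite uS normrM gtr0_norm// mulrC -ltr_pdivlMr.
  (* The value M at 1 accounts for the last increment, from a point of the path to its limit y. *)
  apply/(path_lengthP _ ler01); exists (fun t => if t < 1 then L (u t) else M).
  move=> s t; rewrite /= !in_itv/= => /andP[s0 s1] /andP[t0 t1] st; rewrite /p.
  have [t1'|t1'] := ltP t 1; have [s1'|s1'] := ltP s 1.
  - have us : a <= u s < b by apply: uab; rewrite s0.
    have ut : a <= u t < b by apply: uab; rewrite t0.
    by apply: dom; rewrite /= ?in_itv//; exact: u_le.
  - by exfalso; lra.
  - by apply: Leq; apply: uab; rewrite s0.
  - by rewrite mdistxx subrr.
have hql : lift_on f p 1 (q \o u).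
  split; last by move=> t /andP[t0 t1]; rewrite /p t1.
  apply/within_continuous_realP => t; rewrite /= in_itv/= => tb N nN.
  have [d d0 Hd] := (within_continuous_realP _ _).1 cq (u t) (uab t tb) _ nN.
  exists (d / (b - a)); first by rewrite divr_gt0.
  move=> s; rewrite in_itv/= => sb h; apply: Hd; first by rewrite /= in_itv/=; apply: uab.
  by rewrite uS normrM gtr0_norm// mulrC -ltr_pdivlMr.
have [|alpha [a0 Ha]] := c4 p pP 1 _ _ hql; first by rewrite ltr01 lexx.
apply/hpath_lengthP; exists (fun t => L t / (alpha / 2)), (M / (alpha / 2)); split.
  apply: bounded_lift_dominated => // t tab; apply: Ha.
  have uK : u ((t - a) / (b - a)) = t by rewrite /u mulrC divfK ?lt0r_neq0//; ring.
  exists ((t - a) / (b - a)); last by rewrite /= uK.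
  have /andP[at_ tb] := tab.
  by rewrite /= in_itv/= ler_pdivlMr// ltr_pdivrMr//; apply/andP; split; lra.
move=> t /LM LtM; rewrite ler_pM2r// invr_gt0 divr_gt0//.
Qed.

End Continuation.

(** * Weights *)

Section Weights.
Context {R : realType}.

Lemma weight_cst1 : weight (fun _ : R => 1).
Proof.
split=> //; under eq_integral do rewrite invr1.
by rewrite integral_cst//= lebesgue_measure_itv/= ltry mul1e.
Qed.

(** If these sums stayed below a bound, so would the integral of the step function equal to 1 / w n
    on [n, n + 1[, which is at least 1 / w because [w] is nondecreasing. The index n + 1 is the one
    met when a distance grows from n to n + 1. *)
Lemma weight_series_unbounded (w : R -> R) (B : R) (n0 : nat) : weight w ->
  exists2 N, (n0 <= N)%N & B < \sum_(n0 <= n < N) (w n.+1%:R)^-1.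
Proof.
move=> [mw w0 wi]; apply: contrapT => nN.
have bnd N : \sum_(n0 <= n < N) (w n.+1%:R)^-1 <= Num.max B 0.
  have [n0N|Nn0] := leqP n0 N; last by rewrite big_geq ?le_max ?lexx ?orbT// ltnW.
  by rewrite le_max; apply/orP; left; rewrite leNgt; apply/negP => h; apply: nN; exists N.
pose c (n : nat) := (w n%:R)^-1.
have c0 n : 0 <= c n by rewrite invr_ge0 ltW// w0.
(* The shifted sum from n0 starts at c (n0 + 1); the terms before it are added here. *)
pose C := \sum_(0 <= n < n0.+1) c n + Num.max B 0.
have bndC N : \sum_(0 <= n < N) c n <= C.
  apply: (@le_trans _ _ (\sum_(0 <= n < n0.+1 + N) c n)).
    rewrite (@big_cat_nat _ _ _ N 0%N (n0.+1 + N)) ?leq_addl//= lerDl.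
    by apply: sumr_ge0 => i _.
  rewrite (@big_cat_nat _ _ _ n0.+1 0%N (n0.+1 + N)) ?leq_addr//= lerD2l.
  rewrite addSn big_add1/=; exact: bnd.
pose g (n : nat) (t : R) := ((c n)%:E * (\1_(`[n%:R, n.+1%:R[ : set R) t)%:E)%E.
have g0 n t : (0 <= g n t)%E by rewrite mule_ge0// lee_fin.
pose D := (`[0%R, +oo[%classic : set R).
have fg t : D t -> (((w t)^-1)%:E <= \sum_(0 <= n <oo) g n t)%E.
  rewrite /D /= in_itv/= andbT => t0; pose n := Num.truncn t.
  have /andP[nt tn] : n%:R <= t < n.+1%:R by apply: truncn_itv.
  apply: (@le_trans _ _ (\sum_(0 <= i < n.+1) g i t)%E).
    rewrite big_nat_recr//=; apply: (@le_trans _ _ (g n t)).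
      rewrite /g indicE mem_set/=; last by rewrite in_itv/= nt tn.
      by rewrite mule1 lee_fin lef_pV2 ?posrE ?w0 ?ler0n// mw// ler0n.
    by rewrite leeDr// sume_ge0.
  by apply: nneseries_lim_ge => i _ _.
have : (\int[lebesgue_measure]_(t in D) ((w t)^-1)%:E <= C%:E)%E.
  apply: (@le_trans _ _ (\int[lebesgue_measure]_(t in D) \sum_(0 <= n <oo) g n t)%E).
    (* Comparing the simple functions below each integrand avoids proving that [w] is measurable. *)
    rewrite !ge0_integralE; last 2 first.
    - by move=> t _; apply: nneseries_ge0 => n _ _.
    - by move=> t /=; rewrite /D/= in_itv/= andbT => t0; rewrite lee_fin invr_ge0 ltW// w0.
    apply: ereal_sup_le => _ [h hf <-]; exists h => // t; apply: le_trans (hf t) _.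
    by rewrite /patch; case: ifPn => // /set_mem; exact: fg.
  rewrite integral_nneseries//; last 2 first.
  - exact: measurable_itv.
  - move=> n; apply: measurable_funeM; apply/measurable_EFinP.
    exact: measurable_indic.
  apply: lime_le; first by apply: is_cvg_nneseries => n _ _; exact: integral_ge0.
  exists 0%N => //= N _.
  rewrite (eq_bigr (fun n => (c n)%:E)); last first.
    move=> n _; rewrite /g ge0_integralZl//=; last 3 first.
    - exact: measurable_itv.
    - by apply/measurable_EFinP; exact: measurable_indic.
    - by rewrite lee_fin.
    rewrite integral_indic//; last exact: measurable_itv.
    rewrite (_ : _ `&` _ = `[n%:R, n.+1%:R[%classic); last first.
      apply/setIidPl => t; rewrite /D /= !in_itv/= andbT => /andP[nt _].
      exact: le_trans (ler0n _ _) nt.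
    by rewrite /= lebesgue_measure_itv/= lte_fin ltr_nat ltnSn -EFinB -natrB// subSnn mule1.
  by rewrite sumEFin lee_fin; exact: bndC.
by rewrite wi.
Qed.

End Weights.

(** * Lifts whose distortion is controlled by a weight *)

Section WeightedLifting.
Context {R : realType}.

(** Beyond the intermediate value theorem, [g] is controlled on all of [0, t']. If there were no
    such t', the property that [g] is below c up to time u would be locally constant in u, hence
    true at t. *)
Lemma first_hit (g : R -> R) (t c : R) : 0 <= t ->
  (forall u, 0 <= u <= t -> {for u, continuous g}) -> g 0 < c -> c <= g t ->
  exists t', [/\ 0 <= t' <= t, g t' = c & forall u, 0 <= u <= t' -> g u <= c].
Proof.
move=> t0 cg g0 gt; apply: contrapT => nex.
pose P u := forall v, 0 <= v <= u -> g v < c.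
suff Pt : P t by have := Pt t; rewrite lexx t0 ltNge gt => /(_ isT).
apply: (interval_induction (P := P) (a := 0) (b := t) _ (u := 0)); last 3 first.
- by rewrite lexx.
- by rewrite lexx andbT.
- by move=> v v0; have -> : v = 0 by apply/le_anti; rewrite andbC.
move=> u u0t; have /andP[u0 ut] := u0t.
have [guc|cgu] := ltP (g u) c.
  have : nbhs (g u) [set z | z < c] by exact: lt_nbhsl.
  move=> /(cg u u0t)/nbhs_realP[d d0 Hd]; exists d => // s s' _ _ su s'u Ps v /andP[v0 vs'].
  have [vs|sv] := leP v s; first by apply: Ps; rewrite v0.
  apply: Hd; move: su s'u; rewrite !ltr_norml => /andP[? ?] /andP[? ?].
  by apply/andP; split; lra.
have [H|] := pselect (forall s, 0 <= s < u -> P s); last first.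
  move=> /existsNP[s0 /not_implyP[/andP[s00 s0u] nP]].
  exists (u - s0) => [|s s' _ _]; first by rewrite subr_gt0.
  rewrite ltr_norml => /andP[su _] _ Ps; exfalso; apply: nP => v /andP[v0 vs].
  by apply: Ps; rewrite v0; lra.
have u_gt0 : 0 < u.
  by rewrite lt_neqAle u0 andbT; apply: contraTneq cgu => <-; rewrite -ltNge.
have guc : g u <= c.
  rewrite leNgt; apply/negP => cgu'.
  have : nbhs (g u) [set z | c < z] by exact: lt_nbhsr.
  move=> /(cg u u0t)/nbhs_realP[d d0 Hd].
  pose m := Num.min d u / 2.
  have m0 : 0 < Num.min d u by rewrite lt_min d0.
  have md : Num.min d u <= d by rewrite ge_min lexx.
  have mu : Num.min d u <= u by rewrite ge_min lexx orbT.
  have h1 : 0 <= u - m < u by rewrite /m; apply/andP; split; lra.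
  have : c < g (u - m).
    by apply: Hd; rewrite /m ltr_norml; apply/andP; split; lra.
  by rewrite ltNge ltW//; apply: (H _ h1); case/andP: h1 => -> _ /=.
case: nex; exists u; split=> //; first by apply/le_anti; rewrite guc.
move=> v /andP[v0]; rewrite le_eqVlt => /orP[/eqP-> //|vu].
by apply/ltW/(H v); rewrite ?v0 ?lexx ?vu.
Qed.

Lemma le_mul_ereal (D : \bar R) (alpha w W : R) : 0 < alpha -> 0 < w -> w <= W ->
  (alpha%:E <= D * w%:E)%E -> ((alpha / W)%:E <= D)%E.
Proof.
move=> a0 w0 wW; have W0 : 0 < W by apply: lt_le_trans wW.
case: D => [r| |]; last 2 first.
- by rewrite leey.
- by rewrite gt0_mulNye ?lte_fin// leeNy_eq.
rewrite -EFinM !lee_fin ler_pdivrMr// => h.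
have r0 : 0 < r by rewrite -(pmulr_lgt0 r w0); exact: lt_le_trans h.
by apply: le_trans h _; rewrite ler_wpM2l// ltW.
Qed.

Context {X Y : metricType R} {f : X -> Y}.

Lemma weighted_bounded_lifting (w : R -> R) (p : R -> Y) : weight w ->
  rectifiable_path01 p -> bounded_path_lifting_w f w p -> bounded_path_lifting f p.
Proof.
move=> hw [cp /(path_lengthP _ ler01)[L dom]] bl b q b01 ql.
have [mw w0 _] := hw.
have [x0 [alpha [a0 Ha]]] := bl b q b01 ql; have /andP[b0 b1] := b01.
have cq : {within `[0, b[, continuous q} by case: ql.
have domq := lift_dominated b1 ql dom.
pose q' := q \o Num.max (0 : R).
pose g t := mdist (q' t) x0.
have q'E t : 0 <= t -> q' t = q t by move=> t0; rewrite /q' /= (max_idPr t0).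
have cg u : u < b -> {for u, continuous g}.
  by move=> ub; apply: continuous_mdist_at; exact: (half_open_continuous b0 cq ub).
have DW t W : 0 <= t < b -> g t <= W -> ((alpha / w W)%:E <= Dminus f (q t))%E.
  move=> tb gW; have /andP[t0 _] := tb.
  have gt0 : 0 <= mdist (q t) x0 := mdist_ge0 _ _.
  apply: (@le_mul_ereal _ _ (w (mdist (q t) x0))) => //.
  - exact: w0.
  - by apply: mw => //; rewrite -q'E.
  - by apply: Ha; exists t => //=; rewrite in_itv.
(* Integer levels from n0 on lie above the initial distance, so the lift has to cross each of them
   to get farther. *)
pose n0 := (Num.truncn (g 0)).+1.
have gn0 : g 0 < n0%:R by exact: truncnS_gt.
have Lmono s t : 0 <= s -> s <= t -> t < b -> L s <= L t.
  move=> s0 st tb; apply: (dominated_le domq) => //; rewrite /= in_itv/=;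
  by apply/andP; split; lra.
have key N : (n0 <= N)%N -> forall t, 0 <= t < b -> N%:R <= g t ->
    (alpha / 2) * \sum_(n0 <= n < N) (w n.+1%:R)^-1 <= L t - L 0.
  elim: N => [|N IH]; first by rewrite ltn0.
  rewrite leq_eqVlt => /orP[/eqP <-|].
    by move=> t /andP[t0 tb] _; rewrite big_geq// mulr0 subr_ge0 Lmono.
  rewrite ltnS => n0N t /andP[t0 tb] gt.
  have gN : g 0 < N%:R by apply: lt_le_trans gn0 _; rewrite ler_nat.
  have gN1 : g 0 < N.+1%:R by apply: lt_trans gN _; rewrite ltr_nat.
  (* t2 is a time at level N + 1 before which that level is not exceeded, and t1 <= t2 a time at
     level N. On [t1, t2] the weight is at most w (N + 1) while the lift moves by at least 1. *)
  have [|t2 [/andP[t20 t2t] gt2 le2]] := first_hit t0 _ gN1 gt.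
    by move=> u /andP[_ ut]; apply: cg; lra.
  have NN1 : N%:R <= g t2 by rewrite gt2 ler_nat.
  have [|t1 [/andP[t10 t12] gt1 _]] := first_hit t20 _ gN NN1.
    by move=> u /andP[_ ut]; apply: cg; lra.
  have wN : 0 < w N.+1%:R by exact: w0.
  have A u : `[t1, t2]%classic u -> 0 <= u < b /\ g u <= N.+1%:R.
    rewrite /= in_itv/= => /andP[h1 h2]; split; first by apply/andP; split; lra.
    by apply: le2; apply/andP; split; lra.
  have hd : dominated q (fun t => L t / (alpha / w N.+1%:R / 2)) `[t1, t2].
    apply: (mean_value (f := f) (alpha := alpha / w N.+1%:R)).
    - have : 0 < alpha / w N.+1%:R by exact: divr_gt0.
      by move=> ?; apply/andP; split; lra.
    - move=> s u v; rewrite /= !in_itv/= => /andP[? ?] /andP[? ?] /andP[? ?].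
      by apply/andP; split; lra.
    - apply: continuous_subspaceW cq => u /A[]; by rewrite /= in_itv.
    - by move=> u /A[u1 u2]; exact: DW.
    - by apply: dominatedS domq => u /A[]; rewrite /= in_itv.
  have h1 : 1 <= mdist (q t1) (q t2).
    have := metric_triangle (q t2) (q t1) x0; rewrite [mdist (q t2) (q t1)]metric_sym.
    have -> : mdist (q t1) x0 = N%:R by rewrite -q'E.
    have -> : mdist (q t2) x0 = N.+1%:R by rewrite -q'E.
    rewrite -natr1; lra.
  have := hd t1 t2; rewrite /= !in_itv/= !lexx t12 => /(_ isT isT isT).
  rewrite -mulrBl => /(le_trans h1); rewrite ler_pdivlMr ?divr_gt0// mul1r => h2.
  have := IH n0N t1; rewrite t10 gt1 lexx => /(_ _ isT) h3.
  have {}h3 := h3 (le_lt_trans t12 (le_lt_trans t2t tb)).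
  have h4 := Lmono t2 t t20 t2t tb.
  rewrite big_nat_recr//= mulrDr.
  have -> : alpha / 2 * (w N.+1%:R)^-1 = alpha / w N.+1%:R / 2 by rewrite mulrAC.
  by lra.
(* Reaching level N would cost more arc length than the total L 1 - L 0 available. *)
have [N n0N HN] := weight_series_unbounded ((L 1 - L 0) / (alpha / 2)) n0 hw.
have bnd t : 0 <= t < b -> g t <= N%:R.
  move=> tb; rewrite leNgt; apply/negP => /ltW /(key N n0N t tb).
  move: HN; rewrite ltr_pdivrMr ?divr_gt0// mulrC => HN.
  have : L t <= L 1; last by lra.
  have /andP[? ?] := tb.
  by apply: (dominated_le dom) => //; rewrite /= ?in_itv/=; try (apply/andP; split); lra.
exists (alpha / w N%:R); split; first by rewrite divr_gt0// w0.
by move=> x [t] /=; rewrite in_itv/= => tb <-; exact: DW (bnd t tb).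
Qed.

End WeightedLifting.

(** * Pasting, concatenation and reversal of paths *)

Section Paths.
Context {R : realType}.

(** Pasting along the zero set of [c]. Later definitions by cases compare an affine expression with
    0 so as to fall under this form. *)
Lemma continuous_if (S T : topologicalType) (c : S -> R) (g h : S -> T) :
  continuous c -> continuous g -> continuous h -> (forall s, c s = 0 -> g s = h s) ->
  continuous (fun s => if c s <= 0 then g s else h s).
Proof.
move=> cc cg ch gh s; have [cs0|cs0|cs0] := ltgtP (c s) 0.
- apply: (near_eq_continuous (q' := g)); last exact: cg.
  have : nbhs s [set v | c v < 0] by exact: cc s _ (lt_nbhsl cs0).
  by apply: filterS => v /= /ltW ->.
- apply: (near_eq_continuous (q' := h)); last exact: ch.
  have : nbhs s [set v | 0 < c v] by exact: cc s _ (lt_nbhsr cs0).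
  by apply: filterS => v /=; rewrite leNgt => ->.
- apply/continuous_atP => N; rewrite cs0 lexx => gN.
  have hN : nbhs (h s) N by rewrite -gh.
  have : nbhs s (g @^-1` N `&` h @^-1` N) by apply: filterI; [exact: cg|exact: ch].
  by apply: filterS => v [/= ? ?]; case: ifP.
Qed.

Definition path_between (T : topologicalType) (x y : T) (g : R -> T) :=
  [/\ continuous g, forall t, t <= 0 -> g t = x & forall t, 1 <= t -> g t = y].

(** Reparametrisations are written in this shape, even as [2 * t + 0] or [-1 * t + 1], so that one
    lemma serves them all. *)
Lemma affine_continuous (a b : R) : continuous (fun t : R => a * t + b).
Proof.
by move=> t; apply: cvgD; [apply: cvgM; [exact: cvg_cst|exact: cvg_id]|exact: cvg_cst].
Qed.

Lemma affine_comp_continuous (T : topologicalType) (g : R -> T) (a b : R) :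
  continuous g -> continuous (fun t => g (a * t + b)).
Proof.
move=> cg t; have := (@continuous_at_comp _ _ _ g (fun t : R => a * t + b) t).
by apply; [exact: cg|exact: affine_continuous].
Qed.

Lemma path_between_cat (T : topologicalType) (x y z : T) (g h : R -> T) :
  path_between x y g -> path_between y z h ->
  path_between x z (fun t => if 2 * t + (-1) <= 0 then g (2 * t + 0) else h (2 * t + (-1))).
Proof.
move=> [cg g0 g1] [ch h0 h1]; split.
- apply: continuous_if.
  + exact: affine_continuous.
  + exact: affine_comp_continuous.
  + exact: affine_comp_continuous.
  + by move=> t t2; rewrite h0 ?g1//; lra.
- by move=> t t0; rewrite ifT; [rewrite g0//|]; lra.
- by move=> t t1; rewrite ifF; [rewrite h1//; lra|apply/negbTE; rewrite -ltNge; lra].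
Qed.

Lemma path_between_rev (T : topologicalType) (x y : T) (g : R -> T) :
  path_between x y g -> path_between y x (fun t => g (-1 * t + 1)).
Proof.
move=> [cg g0 g1]; split.
- exact: affine_comp_continuous.
- by move=> t t0; apply: g1; lra.
- by move=> t t1; apply: g0; lra.
Qed.

Lemma clamp_path_between (T : topologicalType) (g : R -> T) :
  {within `[0, 1], continuous g} -> path_between (g 0) (g 1) (g \o clamp).
Proof.
move=> cg; split; first exact: clamp_path_continuous.
- by move=> t t0; rewrite /= clamp_le0.
- by move=> t t1; rewrite /= clamp_ge1.
Qed.

Lemma continuous_path01 (T : metricType R) (g : R -> T) : continuous g -> is_path01 g.
Proof. by move=> cg; apply: continuous_subspaceT. Qed.

End Paths.

(** * Coverings from contractions *)

Section Coverings.
Context {R : realType} {X Y : metricType R} {f : X -> Y} (hf : local_homeo f).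

(** Shortly before [b] the lift lies in one sheet over an evenly covered neighbourhood of p b, and
    by uniqueness it stays there as s \o p; it therefore tends to s (p b). *)
Lemma covering_continues (p : R -> Y) : covering_projection f -> continuous p ->
  continues (f := f) p.
Proof.
move=> [cf _ cov] cp b q b01 cq fq.
have [U [oU Ub [P [fU HP _]]]] := cov (p b).
have /nbhs_realP[d d0 Hd] := cp b _ (open_nbhs_nbhs (conj oU Ub)).
pose t0 := b - d / 2.
have : (f @^-1` U) (q t0).
  by rewrite /= fq /t0; [apply: Hd; rewrite ltr_norml; apply/andP; split|]; lra.
rewrite fU => -[V PV Vt0]; have [oV hV] := HP V PV.
have [_ [s hs]] := homeo_on_section oV oU hV; have [_ _ Vs Us cs] := hs.
have Up t : t0 <= t <= b -> U (p t).
  by rewrite /t0 => /andP[? ?]; apply: Hd; rewrite ltr_norml; apply/andP; split; lra.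
have qs t : t0 <= t -> t < b -> q t = s (p t).
  move=> t0t tb; have tU u : t0 <= u <= t -> U (p u).
    by move=> /andP[h1 h2]; apply: Up; rewrite h1; lra.
  apply: (unique_lift hf (S := q) (S' := s \o p) (a := t0) (b := t) (t0 := t0)).
  - by move=> u /andP[_ ut]; apply: cq; lra.
  - by move=> u /tU Uu; apply: continuous_at_comp (cp u); exact: cs.
  - by move=> u /[dup] /tU /Us[_ /= ->] /andP[_ ut]; apply: fq; lra.
  - by rewrite lexx.
  - by rewrite /= -fq ?(Vs _ Vt0).2//; lra.
  - by rewrite t0t lexx.
exists (s (p b)) => N nN e e0.
have csp : {for b, continuous (s \o p)} by apply: continuous_at_comp (cp b); exact: cs.
have /nbhs_realP[r r0 Hr] := csp _ nN.
pose m := Num.min (Num.min e r) (d / 2) / 2.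
have m0 : 0 < m by rewrite divr_gt0// !lt_min e0 r0 divr_gt0.
have mE : m * 2 = Num.min (Num.min e r) (d / 2) by rewrite /m divfK.
have me : m * 2 <= e by rewrite mE !ge_min lexx.
have mr : m * 2 <= r by rewrite mE !ge_min lexx orbT.
have md : m * 2 <= d / 2 by rewrite mE !ge_min lexx !orbT.
exists (b - m); first by apply/andP; split; lra.
rewrite qs; [|by rewrite /t0; lra|by lra].
by apply: Hr; rewrite ltr_norml; apply/andP; split; lra.
Qed.

Lemma local_section_homeo_on (V : set X) (W : set Y) (s : Y -> X) :
  local_section f V W s -> homeo_on f V W.
Proof.
move=> [oV oW Vs Ws cs]; have [cf _] := hf; split.
- apply/seteqP; split=> [_ [x Vx <-]|y Wy]; first by case: (Vs x Vx).
  by exists (s y); case: (Ws y Wy).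
- exact: continuous_subspaceT.
- exists s; split.
  + apply/seteqP; split=> [_ [y Wy <-]|x Vx]; first by case: (Ws y Wy).
    by exists (f x); case: (Vs x Vx).
  + by move=> x /Vs[].
  + by move=> y /Ws[].
  + by apply: continuous_in_subspaceT => y; rewrite inE; exact: cs.
Qed.

(* A contraction of a neighbourhood of [y0] (parametrised by the whole line and
   constant outside [0,1]), all of whose paths lift to [X] from either end. *)
Definition liftable_contraction (y0 : Y) (U : set Y) (H : Y * R -> Y) :=
  [/\ open U, U y0,
      forall y t, U y -> {for (y, t), continuous H},
      (forall t, H (y0, t) = y0) /\ (forall y, U y -> H (y, 0) = y0 /\ H (y, 1) = y) &
      forall y x (e : R), U y -> e = 0 \/ e = 1 -> f x = H (y, e) ->
        exists q : R -> X, [/\ continuous q, forall t, f (q t) = H (y, t) & q e = x]].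

Definition liftable_contractible := forall y0, exists U H, liftable_contraction y0 U H.

(** From the centre a contraction path lifts as it stands; from its other end the reversed path is
    lifted, whose length is finite too. Clamping the time makes the contraction continuous at every
    real time. *)
Lemma rectifiable_liftable_contractible : locally_R_contractible Y ->
  (forall p : R -> Y, rectifiable_path01 p -> continuation_property f p) ->
  liftable_contractible.
Proof.
move=> lc cont y0; have [U [oU [Uy0 [H [cH UH Hy0 H01 rH]]]]] := lc y0.
have lift (p : R -> Y) x : rectifiable_path01 p -> f x = p 0 ->
    exists q : R -> X, [/\ continuous q, forall t, f (q t) = p (clamp t) & q 0 = x].
  move=> rp fx; apply: (path_lift hf (p := p \o clamp)).
  - by apply: clamp_path_continuous; case: rp.
  - by move=> t /=; rewrite clampK.
  - exact: continuation_continues (cont p rp).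
  - by rewrite /= clamp_id// lexx ler01.
pose K (z : Y * R) := H (z.1, clamp z.2).
have cK y t : U y -> {for (y, t), continuous K}.
  move=> Uy; apply: (within_continuous_comp (g := fun z => (z.1, clamp z.2)) cH).
    exists (U, setT) => /=; first by split; [exact: open_nbhs_nbhs|exact: filterT].
    by move=> [z u] [/= Uz _]; split=> //=; rewrite in_itv/= clamp01.
  apply: continuous_at_pair; first exact: cvg_fst.
  apply: (continuous_at_comp (g := snd)); [exact: clamp_continuous|exact: cvg_snd].
have cKy y (g : R -> R) : U y -> continuous g -> continuous (fun t => K (y, g t)).
  move=> Uy cg t; apply: (continuous_at_comp (g := fun t => (y, g t))); first exact: cK.
  by apply: continuous_at_pair; [exact: cst_continuous|exact: cg].
have rK y : U y -> rectifiable_path01 (fun t => K (y, t)).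
  move=> Uy; split; first by apply/continuous_path01/(cKy y id Uy) => t; exact: cvg_id.
  apply/(path_lengthP _ ler01); have /(path_lengthP _ ler01)[L dom] := rH y Uy.
  exists L => s t sI tI st; have := dom s t sI tI st.
  by move: sI tI; rewrite /= !in_itv/= /K/= => /clamp_id -> /clamp_id ->.
have rK' y : U y -> rectifiable_path01 (fun t => K (y, -1 * t + 1)).
  move=> Uy; split.
    apply/continuous_path01/(cKy y (fun t => -1 * t + 1) Uy); exact: affine_continuous.
  apply/(path_lengthP _ ler01); have [_ /(path_lengthP _ ler01)[L dom]] := rK y Uy.
  (* Reversal exchanges the ends of each interval, whence the sign. *)
  exists (fun t => - L (-1 * t + 1)) => s t; rewrite /= !in_itv/= => /andP[? ?] /andP[? ?] st.
  have := dom (-1 * t + 1) (-1 * s + 1); rewrite metric_sym /= !in_itv/= => h.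
  by rewrite opprK [leRHS]addrC; apply: h; try (apply/andP; split); lra.
exists U, K; split=> //.
  split=> [t|y Uy]; first by rewrite /K/= Hy0 ?clamp01.
  by rewrite /K/= !clamp_id ?lexx ?ler01//; exact: H01.
move=> y x e Uy e01 fx; case: e01 => e01; subst e.
  have [q [cq fq q0]] := lift _ x (rK y Uy) fx.
  by exists q; split=> // t; rewrite fq /K/= clampK.
have [|q [cq fq q0]] := lift _ x (rK' y Uy); first by rewrite mulr0 add0r.
exists (fun t => q (-1 * t + 1)); split.
- exact: affine_comp_continuous.
- by move=> t; rewrite fq /K/= clamp_rev clampK clamp_rev; congr (H (_, _)); ring.
- by rewrite mulr1 addNr.
Qed.

Lemma contraction_section (x : X) (U : set Y) (H : Y * R -> Y) :
  liftable_contraction (f x) U H ->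
  exists F : Y -> R -> X, [/\
    (forall y, U y -> [/\ continuous (F y), forall t, f (F y t) = H (y, t) & F y 0 = x]),
    (forall t, F (f x) t = x) &
    local_section f [set F y 1 | y in U] U (fun y => F y 1)].
Proof.
move=> [oU Ux cH [Hx H01] lift].
have [F hF] : exists F : Y -> R -> X, forall y, U y ->
    [/\ continuous (F y), forall t, f (F y t) = H (y, t) & F y 0 = x].
  have /(@choice Y (R -> X)) : forall y, exists q : R -> X, U y ->
      [/\ continuous q, forall t, f (q t) = H (y, t) & q 0 = x]; last first.
    by move=> [F hF]; exists F.
  move=> y.
  have [Uy|nUy] := pselect (U y); last by exists (fun=> x).
  have [|q hq] := lift y x 0 Uy (or_introl erefl); last by exists q.
  by case: (H01 y Uy).
have Fx t : F (f x) t = x.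
  have [cq fq q0] := hF _ Ux.
  have -> // : F (f x) = cst x.
  by apply: (lift_unique hf cq _ _ q0) => [|u]; [exact: cst_continuous|rewrite fq Hx].
have cF y : U y -> {for y, continuous (fun y => F y 1)}.
  move=> Uy; apply: (continuous_at_comp (p := fun z => F z.1 z.2) (g := fun y => (y, 1))).
    apply: (homotopy_lift hf (F := fun z => F z.1 z.2) oU cH) => //=.
    - by move=> z t /hF[].
    - by move=> z /hF[].
    - move=> z Uz; apply: (near_eq_continuous (q' := cst x)); last exact: cst_continuous.
      by apply: filterS (open_nbhs_nbhs (conj oU Uz)) => v /hF[].
  by apply: continuous_at_pair; [exact: cvg_id|exact: cst_continuous].
have fF y : U y -> f (F y 1) = y.
  by move=> Uy; have [_ -> _] := hF y Uy; case: (H01 y Uy).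
exists F; split=> //; split=> //.
(* Let [f] be injective on [V] around F y 1. For z in [V] close to F y 1, F (f z) 1 lies in [V] too
   and has the same image as z, so it is z, which thus belongs to the sheet. *)
- rewrite openE => _ [y Uy <-]; rewrite /interior.
  have [cf lf] := hf; have [V [W [s [Vz [oV oW Vs Ws cs]]]]] := lf (F y 1).
  have nN : nbhs y (U `&` (fun y => V (F y 1))).
    by apply: filterI; [exact: open_nbhs_nbhs|apply: cF => //; exact: open_nbhs_nbhs].
  rewrite -[X in nbhs X](fF y Uy) in nN; have nN' := (continuous_atP _ _).1 (cf _) _ nN.
  apply: filterS (filterI (open_nbhs_nbhs (conj oV Vz)) nN') => z [Vz' [/= Ufz VFz]].
  exists (f z) => //; have [_ <-] := Vs _ VFz.
  by rewrite fF//; case: (Vs z Vz').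
- by move=> _ [y Uy <-]; rewrite fF.
- by move=> y Uy; rewrite fF//; split=> //; exists y.
Qed.

Lemma liftable_contractible_covering : path_connected Y -> (exists x : X, True) ->
  liftable_contractible -> covering_projection f.
Proof.
move=> pY [x0 _] lc; have [cf lf] := hf; split=> //.
  rewrite -subTset => y _ /=.
  have [p [cp p0 p1]] := pY (f x0) y; have [cp' _ _] := clamp_path_between cp.
  have : exists x, f x = p (clamp 1).
    apply: (interval_induction (P := fun t => exists x, f x = p (clamp t))
      (a := 0) (b := 1) _ (u := 0)); last 3 first.
    - by rewrite lexx ler01.
    - by rewrite lexx ler01.
    - by exists x0; rewrite clamp_id ?lexx ?ler01.
    (* Within one contractible neighbourhood, a preimage of p u is moved back along its contraction
       path to the fibre over the centre, then forward to a preimage of p v. *)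
    move=> t _; have [U [H [oU Ut _ [_ H01] lift]]] := lc (p (clamp t)).
    have /nbhs_realP[d d0 Hd] := cp' t _ (open_nbhs_nbhs (conj oU Ut)).
    exists d => // u v _ _ /Hd/= Uu /Hd/= Uv [x fx].
    have [|q [_ fq _]] := lift _ x 1 Uu (or_intror erefl).
      by rewrite fx; case: (H01 _ Uu).
    have [|q' [_ fq' _]] := lift _ (q 0) 0 Uv (or_introl erefl).
      by rewrite fq (H01 _ Uu).1 (H01 _ Uv).1.
    by exists (q' 1); rewrite fq' (H01 _ Uv).2.
  by rewrite clamp_id ?lexx ?ler01// p1 => -[x fx]; exists x.
move=> y0; have [U [H hUH]] := lc y0; exists U; have [oU Uy0 _ [_ H01] lift] := hUH.
split=> //.
have [F hF] : exists F : X -> Y -> R -> X, forall x, f x = y0 -> [/\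
    (forall y, U y -> [/\ continuous (F x y), forall t, f (F x y t) = H (y, t) & F x y 0 = x]),
    (forall t, F x (f x) t = x) &
    local_section f [set F x y 1 | y in U] U (fun y => F x y 1)].
  have /(@choice X (Y -> R -> X)) : forall x, exists F : Y -> R -> X, f x = y0 -> [/\
    (forall y, U y -> [/\ continuous (F y), forall t, f (F y t) = H (y, t) & F y 0 = x]),
    (forall t, F (f x) t = x) &
    local_section f [set F y 1 | y in U] U (fun y => F y 1)]; last first.
    by move=> [F hF]; exists F.
  move=> x.
  have [fx|nfx] := pselect (f x = y0); last by exists (fun _ _ => x).
  by have := hUH; rewrite -fx => /contraction_section[F hF]; exists F.
exists [set V | exists2 x, f x = y0 & V = [set F x y 1 | y in U]]; split.
- apply/seteqP; split=> [z Uz|z [_ [x fx ->] [y Uy <-]]]; last first.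
    have [hFx _ _] := hF x fx; have [_ /= -> _] := hFx y Uy.
    by rewrite (H01 y Uy).2.
  (* Lifting backwards from z reaches the point q 0 of the fibre whose sheet contains z. *)
  have [|q [cq fq q1]] := lift _ z 1 Uz (or_intror erefl); first by case: (H01 _ Uz).
  have fq0 : f (q 0) = y0 by rewrite fq; case: (H01 _ Uz).
  exists [set F (q 0) y 1 | y in U]; first by exists (q 0).
  exists (f z) => //; have [hFq _ _] := hF _ fq0; have [cF fF F0] := hFq _ Uz.
  have -> // : F (q 0) (f z) = q.
  by apply: (lift_unique hf cF cq _ F0) => t; rewrite fF fq.
- move=> _ [x fx ->]; have [_ _ hs] := hF x fx; split; first by case: hs.
  exact: local_section_homeo_on hs.
- move=> _ _ [x fx ->] [x' fx' ->] [z [[y Uy yz] [y' Uy' yz']]].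
  have [hFx _ _] := hF x fx; have [cF fF F0] := hFx y Uy.
  have [hFx' _ _] := hF x' fx'; have [cF' fF' F0'] := hFx' y' Uy'.
  (* Applying [f] to the common point gives y = y'. The two lifts then agree at time 1, hence at
     time 0, where they start at x and x'. *)
  have yy' : y = y'.
    by rewrite -(H01 y Uy).2 -(H01 y' Uy').2 -fF -fF' yz yz'.
  subst y'; suff -> : x = x' by [].
  rewrite -F0 -F0'; congr (_ 0); apply: (lift_unique hf cF cF' _ (t0 := 1)).
    by move=> t; rewrite fF fF'.
  by rewrite yz yz'.
Qed.

(** Lifted contraction paths join each point to all those of a neighbourhood, so the set of points
    reachable from [x] is open and closed. *)
Lemma liftable_contractible_path_connected : connected [set: X] ->
  liftable_contractible -> forall x y : X, exists g : R -> X, path_between x y g.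
Proof.
move=> cX lc x y.
have loc z : \forall z' \near z, exists g : R -> X, path_between z z' g.
  have [U [H hUH]] := lc (f z); have [F [hF Fz [oV oU Vs Us cs]]] := contraction_section hUH.
  have Vz : [set F y 1 | y in U] z by exists (f z); [case: hUH|exact: Fz].
  apply: filterS (open_nbhs_nbhs (conj oV Vz)) => _ [y' Uy' <-].
  exists (F y' \o clamp); have [cF _ {1}<-] := hF y' Uy'.
  exact/clamp_path_between/continuous_subspaceT.
pose S := [set z | exists g : R -> X, path_between x z g].
suff : S = setT by move/seteqP => [_ /(_ y I)].
apply: cX.
- exists x, (fun=> x); split=> //; exact: cst_continuous.
- exists S; last by rewrite setTI.
  rewrite openE => z [g hg]; apply: filterS (loc z) => z' [g' hg'].
  by eexists; exact: path_between_cat hg hg'.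
- exists S; last by rewrite setTI.
  move=> z clz; have [z' [[g hg] [g' /path_between_rev hg']]] := clz _ (loc z).
  by eexists; exact: path_between_cat hg hg'.
Qed.

End Coverings.

(** * Path homotopies and fundamental groups *)

Section PathHomotopy.
Context {R : realType}.

Lemma continuous_pair (S T U V : topologicalType) (K : T * U -> V) (g : S -> T) (h : S -> U) :
  continuous K -> continuous g -> continuous h -> continuous (fun z => K (g z, h z)).
Proof.
move=> cK cg ch z.
have := @continuous_at_comp _ _ _ K (fun z => (g z, h z)) z; apply; first exact: cK.
by apply: continuous_at_pair; [exact: cg|exact: ch].
Qed.

Lemma continuous_comp_fun (S T U : nbhsType) (p : T -> U) (g : S -> T) :
  continuous p -> continuous g -> continuous (fun z => p (g z)).
Proof. by move=> cp cg z; exact: cvg_comp (cg z) (cp _). Qed.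

(** * Homotopies with fixed ends, and conjugation of loops *)

Section Homotopic.
Context {T : metricType R}.
Implicit Types (x y : T) (g h : R -> T).

(** [K] is continuous on the plane, while the boundary conditions bear on the unit square only;
    clamping both variables passes between this form and continuity within the square. *)
Definition path_homotopic x y g h := exists K : R * R -> T,
  [/\ continuous K, forall s, 0 <= s <= 1 -> K (s, 0) = g s /\ K (s, 1) = h s &
      forall t, 0 <= t <= 1 -> K (0, t) = x /\ K (1, t) = y].

Lemma within_square_clamp (K : R * R -> T) :
  {within `[0, 1]%classic `*` `[0, 1]%classic, continuous K} ->
  continuous (fun z => K (clamp z.1, clamp z.2)).
Proof.
move=> cK z.
have := @within_continuous_comp _ _ _ _ K (fun z => (clamp z.1, clamp z.2)) z cK.
apply; first by apply: filterS filterT => v _; split; rewrite /= in_itv/= clamp01.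
apply: continuous_at_pair.
  by apply: (continuous_at_comp (g := fst)); [exact: clamp_continuous|exact: cvg_fst].
by apply: (continuous_at_comp (g := snd)); [exact: clamp_continuous|exact: cvg_snd].
Qed.

Lemma path_homotopic_clamp x y g h : path_homotopic x y g h ->
  exists K : R * R -> T, [/\ continuous K,
    forall s, K (s, 0) = g (clamp s) /\ K (s, 1) = h (clamp s),
    forall t, K (0, t) = x /\ K (1, t) = y &
    forall s t, K (clamp s, t) = K (s, t)].
Proof.
move=> [K [cK Kg Kx]]; exists (fun z => K (clamp z.1, clamp z.2)); split.
- by apply: within_square_clamp; exact: continuous_subspaceT.
- by move=> s /=; rewrite !(@clamp_id R 0, @clamp_id R 1) ?lexx ?ler01//; apply: Kg; exact: clamp01.
- by move=> t /=; rewrite !(@clamp_id R 0, @clamp_id R 1) ?lexx ?ler01//; apply: Kx; exact: clamp01.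
- by move=> s t /=; rewrite clampK.
Qed.

Lemma loop_homotopicP x g h : loop_homotopic x g h <-> path_homotopic x x g h.
Proof.
split=> [[K [cK Kg Kx]]|[K [cK Kg Kx]]]; last first.
  by exists K; split=> //; exact: continuous_subspaceT.
exists (fun z => K (clamp z.1, clamp z.2)); split; first exact: within_square_clamp.
- by move=> s s01 /=; rewrite !clamp_id ?lexx ?ler01//; exact: Kg.
- by move=> s s01 /=; rewrite !clamp_id ?lexx ?ler01//; exact: Kx.
Qed.

Lemma path_homotopic_sym x y g h : path_homotopic x y g h -> path_homotopic x y h g.
Proof.
move=> [K [cK Kg Kx]]; exists (fun z => K (z.1, -1 * z.2 + 1)); split.
- apply: continuous_pair cK _ _; first by move=> z; exact: cvg_fst.
  by apply: (continuous_comp_fun (p := fun t : R => -1 * t + 1));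
    [exact: affine_continuous|move=> z; exact: cvg_snd].
- by move=> s s01 /=; rewrite mulr0 add0r mulr1 addNr; case: (Kg s s01).
- by move=> t /andP[t0 t1] /=; apply: Kx; apply/andP; split; lra.
Qed.

Lemma path_homotopic_trans x y g h k : path_homotopic x y g h ->
  path_homotopic x y h k -> path_homotopic x y g k.
Proof.
move=> /path_homotopic_clamp[K [cK Kg Kx _]] /path_homotopic_clamp[K' [cK' Kg' Kx' _]].
have c2 a b : continuous (fun z : R * R => a * z.2 + b).
  by apply: (continuous_comp_fun (p := fun t : R => a * t + b));
    [exact: affine_continuous|move=> z; exact: cvg_snd].
exists (fun z => if 2 * z.2 + (-1) <= 0 then K (z.1, clamp (2 * z.2 + 0))
                 else K' (z.1, clamp (2 * z.2 + (-1)))); split.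
- apply: continuous_if.
  + exact: c2.
  + apply: continuous_pair cK _ _; first by move=> z; exact: cvg_fst.
    by apply: (continuous_comp_fun (p := clamp)); [exact: clamp_continuous|exact: c2].
  + apply: continuous_pair cK' _ _; first by move=> z; exact: cvg_fst.
    by apply: (continuous_comp_fun (p := clamp)); [exact: clamp_continuous|exact: c2].
  + move=> z hz; rewrite hz clamp_ge1 ?clamp_le0//; last by lra.
    by rewrite (Kg _).2 (Kg' _).1.
- move=> s s01 /=; split.
    rewrite ifT; last by lra.
    by rewrite clamp_le0 ?(Kg _).1 ?clamp_id//; lra.
  rewrite ifF; last by apply/negbTE; rewrite -ltNge; lra.
  by rewrite clamp_ge1 ?(Kg' _).2 ?clamp_id//; lra.
- by move=> t t01 /=; case: ifP => _; [exact: Kx|exact: Kx'].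
Qed.

(* The loop [d g d^-1], run on [0,3], extended to the whole line. *)
Definition conj_line (d g : R -> T) (s : R) : T :=
  if 1 * s + (-1) <= 0 then d s else
  if 1 * s + (-2) <= 0 then g (clamp (1 * s + (-1))) else d (-1 * s + 3).

Definition conj_loop d g (u : R) := conj_line d g (3 * u + 0).

Lemma conj_line_continuous x y d g : path_between x y d -> loop_at y g ->
  continuous (conj_line d g).
Proof.
move=> [cd d0 d1] [cg g0 g1]; apply: continuous_if => //.
- exact: affine_continuous.
- apply: continuous_if.
  + exact: affine_continuous.
  + by apply: (affine_comp_continuous (g := g \o clamp)); exact: clamp_path_continuous.
  + exact: affine_comp_continuous.
  + by move=> s s2; rewrite clamp_ge1 ?g1 ?d1//; lra.
- move=> s s1; rewrite ifT; last by lra.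
  by rewrite s1 clamp_le0// g0 d1//; lra.
Qed.

Lemma conj_loop_between x y d g : path_between x y d -> loop_at y g ->
  path_between x x (conj_loop d g).
Proof.
move=> hd hg; split.
- by apply: affine_comp_continuous; exact: conj_line_continuous hd hg.
- by move=> t t0; rewrite /conj_loop /conj_line ifT; [case: hd => _ -> //|]; lra.
- move=> t t1; rewrite /conj_loop /conj_line ifF; last by apply/negbTE; rewrite -ltNge; lra.
  rewrite ifF; last by apply/negbTE; rewrite -ltNge; lra.
  by case: hd => _ -> //; lra.
Qed.

(* [g] is homotopic to [d^-1 (d g d^-1) d], by moving the parameter of
   [conj_line d g] linearly from 1 + u to the back-and-forth path [phi]. *)
Lemma conj_loop_inj x y d g h : path_between x y d -> loop_at y g -> loop_at y h ->
  path_homotopic x x (conj_loop d g) (conj_loop d h) -> path_homotopic y y g h.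
Proof.
move=> hd hg hh /path_homotopic_clamp[K [cK Kg Kx Kc]]; have [cd d0 d1] := hd.
have c1 a b : continuous (fun z : R * R => a * z.1 + b).
  by apply: (continuous_comp_fun (p := fun t : R => a * t + b));
    [exact: affine_continuous|move=> z; exact: cvg_fst].
(* Row z.2 of [B] runs d^-1, then row z.2 of [K], then [d], each on a third of [0, 1]. *)
pose B (z : R * R) := if 3 * z.1 + (-1) <= 0 then d (-3 * z.1 + 1) else
  if 3 * z.1 + (-2) <= 0 then K (3 * z.1 + (-1), z.2) else d (3 * z.1 + (-2)).
have cB : continuous B.
  apply: continuous_if; [exact: c1|exact: (continuous_comp_fun cd)| |].
    apply: continuous_if; [exact: c1| |exact: (continuous_comp_fun cd)|].
      by apply: continuous_pair cK _ _; [exact: c1|move=> z; exact: cvg_snd].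
    move=> z hz; rewrite d0; last by lra.
    by have -> : 3 * z.1 + (-1) = 1 by [lra]; rewrite (Kx _).2.
  move=> z hz; rewrite ifT; last by lra.
  by rewrite hz (Kx _).1 d0//; lra.
(* Down from 1 to 0, up to 3 at triple speed, down to 2: along [phi], [conj_line] traces d^-1, the
   conjugated loop and [d]. The ends 1 and 2 are those of the direct course 1 + u. *)
pose phi (u : R) := if 3 * u + (-1) <= 0 then -3 * u + 1 else
  if 3 * u + (-2) <= 0 then 9 * u + (-3) else -3 * u + 5.
have cphi : continuous phi.
  apply: continuous_if; [exact: affine_continuous|exact: affine_continuous| |].
    apply: continuous_if; [exact: affine_continuous|exact: affine_continuous|
      exact: affine_continuous|by move=> s hs; lra].
  by move=> s hs; rewrite ifT; lra.
have BE k s : loop_at y k -> (forall t, 0 <= t <= 1 -> K (t, s) = conj_loop d k t) ->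
    path_homotopic y y k (fun u => B (u, s)).
  move=> hk Ks; have cE := conj_line_continuous hd hk.
  have [ck k0 k1] := hk.
  exists (fun z => conj_line d k ((1 * z.1 + 1) + z.2 * (phi z.1 - (1 * z.1 + 1)))); split.
  - apply: continuous_comp_fun cE _ => z.
    have cf : continuous (fun z : R * R => 1 * z.1 + 1) := c1 1 1.
    apply: cvgD; first exact: cf.
    apply: cvgM; first exact: cvg_snd.
    apply: cvgB; last exact: cf.
    by apply: (continuous_comp_fun cphi) => v; exact: cvg_fst.
  - move=> u u01; have /andP[u0 u1] := u01; split.
      rewrite /= (_ : 1 * u + 1 + 0 * (phi u - (1 * u + 1)) = u + 1); last by ring.
      rewrite /conj_line; have [hu|hu] := leP (1 * (u + 1) + (-1)) 0.
        have -> : u = 0 by lra.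
        by rewrite k0 d1//; lra.
      rewrite ifT; last by lra.
      by rewrite -[RHS](congr1 k (clamp_id u01)); congr (k (clamp _)); ring.
    rewrite /= (_ : 1 * u + 1 + 1 * (phi u - (1 * u + 1)) = phi u); last by ring.
    rewrite /phi /B/=; have [hu|hu] := leP (3 * u + (-1)) 0.
      by rewrite /conj_line ifT//; lra.
    have [hu'|hu'] := leP (3 * u + (-2)) 0.
      rewrite Ks; last by apply/andP; split; lra.
      by rewrite /conj_loop; congr (conj_line _ _ _); ring.
    rewrite /conj_line ifF; last by apply/negbTE; rewrite -ltNge; lra.
    have [hu2|hu2] := leP (1 * (-3 * u + 5) + (-2)) 0; last by congr d; ring.
    by rewrite clamp_ge1 ?k1 ?d1//; lra.
  - have phi0 : phi 0 = 1 by rewrite /phi ifT; lra.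
    have phi1 : phi 1 = 2.
      by rewrite /phi ifF; [rewrite ifF; [lra|]|]; apply/negbTE; rewrite -ltNge; lra.
    move=> t _ /=; rewrite phi0 phi1 /conj_line; split.
      by rewrite ifT; [rewrite d1//|]; lra.
    rewrite ifF; last by apply/negbTE; rewrite -ltNge; lra.
    by rewrite ifT; [rewrite clamp_ge1 ?k1//|]; lra.
apply: path_homotopic_trans (BE g 0 hg _) _.
  by move=> t t01; rewrite (Kg _).1 clamp_id.
apply: path_homotopic_trans (path_homotopic_sym (BE h 1 hh _)); last first.
  by move=> t t01; rewrite (Kg _).2 clamp_id.
exists B; split=> // t _; rewrite /B/=; split; first by rewrite ifT; [rewrite d1//|]; lra.
rewrite ifF; last by apply/negbTE; rewrite -ltNge; lra.
by rewrite ifF; [rewrite d1//; lra|apply/negbTE; rewrite -ltNge; lra].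
Qed.

Lemma path_between_loop x g : path_between x x g -> loop_at x g.
Proof. by move=> [cg g0 g1]; split; [exact: continuous_path01|exact: g0|exact: g1]. Qed.

End Homotopic.

(** * Lifted homotopies, and injectivity on fibres *)

Section Lift.
Context {X Y : metricType R} {f : X -> Y} (hf : local_homeo f).
Context (f_continues : forall p : R -> Y, continuous p -> continues (f := f) p).

(** Each row of the homotopy is lifted from [x]; the lifts are jointly continuous since they all
    start at [x]. Their right ends lift a constant path, hence do not move, and by uniqueness the
    extreme rows are [g] and [h]. *)
Lemma lift_path_homotopic (x : X) (y : Y) (g h : R -> X) : continuous g -> continuous h ->
  g 0 = x -> h 0 = x -> path_homotopic (f x) y (f \o g) (f \o h) ->
  g 1 = h 1 /\ path_homotopic x (g 1) g h.
Proof.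
move=> cg ch g0 h0 /path_homotopic_clamp[K [cK Kg Kx Kc]]; have [cf _] := hf.
have cKt t : continuous (fun s => K (s, t)).
  by apply: continuous_pair cK _ _; [move=> s; exact: cvg_id|exact: cst_continuous].
have /(@choice R (R -> X))[F hF] : forall t, exists q : R -> X,
    [/\ continuous q, forall s, f (q s) = K (s, t) & q 0 = x].
  move=> t; have [||q hq] := path_lift hf (x := x) (cKt t) _ (f_continues (cKt t)).
  - by move=> s; exact: Kc.
  - by case: (Kx t).
  - by exists q.
have cF : continuous (fun z : R * R => F z.1 z.2).
  move=> [t s].
  have := homotopy_lift hf (F := fun z : R * R => F z.1 z.2) (U := setT)
    (H := fun z => K (z.2, z.1)) openT; apply=> //.
  - move=> t' s' _; apply: (continuous_pair cK) => z; [exact: cvg_snd|exact: cvg_fst].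
  - by move=> t' s' _; have [_ ->] := hF t'.
  - by move=> t' _; have [] := hF t'.
  - move=> t' _ /=; have -> : (fun t => F t 0) = cst x by apply/funext => u; have [] := hF u.
    exact: cst_continuous.
have Fe k t : continuous k -> k 0 = x -> (forall s, K (s, t) = f (k (clamp s))) ->
    forall s, F t s = k (clamp s).
  move=> ck k0 Kk s; have [cFt fFt F0] := hF t.
  have ckc : continuous (k \o clamp) by apply: continuous_comp_fun ck (@clamp_continuous R).
  rewrite (lift_unique hf cFt ckc _ (t0 := 0))// => [u|]; first by rewrite fFt Kk.
  by rewrite F0 /= clamp_id ?lexx ?ler01.
have Fg := Fe g 0 cg g0 (fun s => (Kg s).1).
have Fh := Fe h 1 ch h0 (fun s => (Kg s).2).
have F1 t : F t 1 = g 1.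
  have cF1 : continuous (fun t => F t 1).
    by apply: (continuous_pair cF); [move=> u; exact: cvg_id|exact: cst_continuous].
  have e0 : F 0 1 = g 1 by rewrite Fg clamp_id ?lexx ?ler01.
  have fF1 u : f (F u 1) = f (g 1).
    by rewrite -e0; have [_ -> _] := hF u; have [_ -> _] := hF 0; rewrite !(Kx _).2.
  have cc : continuous (fun _ : R => g 1) by exact: cst_continuous.
  exact: (congr1 (fun k => k t) (lift_unique hf cF1 cc fF1 (t0 := 0) e0)).
split; first by rewrite -(F1 1) Fh clamp_id ?lexx ?ler01.
exists (fun z => F z.2 z.1); split.
- by apply: (continuous_pair cF) => z; [exact: cvg_snd|exact: cvg_fst].
- by move=> s s01 /=; rewrite Fg Fh clamp_id.
- by move=> t _ /=; rewrite F1; have [_ _ ->] := hF t.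
Qed.

Lemma path_between_comp (x y : X) (g : R -> X) : path_between x y g ->
  path_between (f x) (f y) (f \o g).
Proof.
have [cf _] := hf; move=> [cg g0 g1]; split; first exact: continuous_comp_fun.
  by move=> t t0; rewrite /= g0.
by move=> t t1; rewrite /= g1.
Qed.

Lemma simply_connected_injective : (forall x y : X, exists g : R -> X, path_between x y g) ->
  simply_connected Y -> injective f.
Proof.
move=> pX [_ sc] x x' fxx'; have [g hg] := pX x x'; have [cg g0 g1] := hg.
have := path_between_comp hg; rewrite -fxx' => /path_between_loop/sc/loop_homotopicP.
(* The constant loop is lifted by the constant path at x, so [g] also ends at x. *)
move=> /(lift_path_homotopic (h := cst x) cg (@cst_continuous _ _ _)) [||+ _] //.
  exact: g0.
by rewrite g1.
Qed.

(* Iterating [m] from [k], pigeonhole yields two equivalent iterates, and [m]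
   reflects the relation back to [k]. *)
Lemma finite_reflecting_surjective (n : nat) (e : 'I_n -> 'I_n -> Prop) (m : 'I_n -> 'I_n) :
  (forall i, e i i) -> (forall i j, e (m i) (m j) -> e i j) -> forall k, exists i, e (m i) k.
Proof.
move=> er em k; apply: contrapT => nk.
have e_iter a b : (a < b)%N -> ~ e (iter b m k) (iter a m k).
  elim: a b => [|a IH] [|b]// ab; last by move=> /em; exact: IH.
  by move=> eb; apply: nk; exists (iter b m k).
suff inj : injective (fun a : 'I_n.+1 => iter a m k).
  by have := leq_card _ inj; rewrite !card_ord ltnn.
move=> a b ab; apply/val_inj; have [lt_ab|lt_ba|//] := ltngtP a b.
  by case: (e_iter _ _ lt_ab); rewrite -ab.
by case: (e_iter _ _ lt_ba); rewrite ab.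
Qed.

(** [Psi] is the map induced by [f], carried to the base point x0 by conjugation with a path [d]
    from a point x1 over y0. It is injective on classes by homotopy lifting; once it is onto, every
    loop at y0 lifts from x1 to a loop, so the fibre over y0 is reduced to x1. *)
Lemma finite_pi1_injective (x0 : X) (y0 : Y) : f @` setT = setT ->
  (forall x y : X, exists g : R -> X, path_between x y g) ->
  pi1_isomorphic x0 y0 -> pi1_finite x0 -> injective f.
Proof.
move=> sf pX [phi [phi_loop phi_hom phi_surj _]] [n [G [G_loop G_all]]].
have [x1 _ fx1] : (f @` setT) y0 by rewrite sf.
have [d hd] := pX x1 x0.
pose Psi g := f \o conj_loop d g.
have cl g : loop_at x0 g -> path_between x1 x1 (conj_loop d g) by exact: conj_loop_between.
have Psi_loop g : loop_at x0 g -> loop_at y0 (Psi g).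
  by move=> /cl/path_between_comp/path_between_loop; rewrite fx1.
have Psi_inj g h : loop_at x0 g -> loop_at x0 h ->
    path_homotopic y0 y0 (Psi g) (Psi h) -> path_homotopic x0 x0 g h.
  move=> hg hh; rewrite -{1}fx1; have [cg g0 g1] := cl g hg; have [ch h0 h1] := cl h hh.
  move=> /(lift_path_homotopic cg ch) [||_]; [exact: g0|exact: h0|].
  by rewrite g1//; exact: conj_loop_inj hd hg hh.
have phiP g h : loop_at x0 g -> loop_at x0 h ->
    path_homotopic x0 x0 g h <-> path_homotopic y0 y0 (phi g) (phi h).
  by move=> hg hh; rewrite -!loop_homotopicP; exact: phi_hom.
have G_phi k : loop_at y0 k -> exists i : 'I_n, path_homotopic y0 y0 (phi (G i)) k.
  move=> /phi_surj[g [hg /loop_homotopicP gk]].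
  have [i [ni /loop_homotopicP gi]] := G_all g hg.
  exists (Ordinal ni); apply: path_homotopic_trans gk; apply/path_homotopic_sym.
  by apply/phiP => //; exact: G_loop.
have hG (i : 'I_n) : loop_at x0 (G i) by exact: G_loop.
(* On indices of representatives, [m] is [Psi] followed by the inverse of [phi]; as both are
   injective on classes, [m] reflects homotopy. *)
have /choice[m hm] : forall i : 'I_n, exists j : 'I_n,
    path_homotopic y0 y0 (phi (G j)) (Psi (G i)).
  by move=> i; apply: G_phi; exact: Psi_loop.
have Psi_surj k : loop_at y0 k -> exists i : 'I_n, path_homotopic y0 y0 k (Psi (G i)).
  move=> /G_phi[j hj].
  have [||i mi] := @finite_reflecting_surjective n
    (fun i i' => path_homotopic x0 x0 (G i) (G i')) m _ _ j.
  - move=> i; have [c g0 g1] := hG i; have cc := clamp_path_continuous c.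
    exists (fun z => G i (clamp z.1)); split.
    + by apply: (continuous_comp_fun cc) => z; exact: cvg_fst.
    + by move=> s s01 /=; rewrite clamp_id.
    + by move=> t _ /=; rewrite !clamp_id ?lexx ?ler01.
  - move=> i i' /phiP => /(_ (hG _) (hG _)) h; apply: Psi_inj => //.
    exact: path_homotopic_trans (path_homotopic_sym (hm i)) (path_homotopic_trans h (hm i')).
  exists i; apply: path_homotopic_trans (hm i); apply: path_homotopic_trans (path_homotopic_sym hj) _.
  by apply: path_homotopic_sym; apply/phiP.
have fib x : f x = y0 -> x = x1.
  move=> fx; have [g hg] := pX x1 x; have [cg g0 g1] := hg.
  have := path_between_comp hg; rewrite fx fx1 => /path_between_loop/Psi_surj[i].
  have [cc c0 c1] := cl _ (hG i).
  rewrite -{1}fx1 => /(lift_path_homotopic cg cc)[||+ _]; [exact: g0|exact: c0|].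
  by rewrite g1// c1.
(* Another fibre is compared with that of y0: the image of a path from a to x1, lifted from b, must
   also end at x1, and uniqueness backwards from there gives a = b. *)
move=> a b fab; have [g /path_between_rev hg] := pX x1 a.
have [cg g0 g1] := hg; have [cp p0 p1] := path_between_comp hg.
have [||q [cq fq q0]] := path_lift hf (x := b) cp _ (f_continues cp).
- move=> t; have [t0|t0] := leP t 0; first by rewrite clamp_le0// !p0.
  have [t1|t1] := leP 1 t; first by rewrite clamp_ge1// !p1.
  by rewrite clamp_id// !ltW.
- by rewrite p0.
have q1 : q 1 = x1 by apply: fib; rewrite fq p1.
have := lift_unique hf cq cg fq (t0 := 1).
by rewrite q1 g1// => /(_ erefl)/(congr1 (fun k => k 0)); rewrite q0 g0.
Qed.

End Lift.

End PathHomotopy.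

(** * Global homeomorphisms *)

Section GlobalHomeomorphism.
Context {R : realType} {X Y : metricType R} {f : X -> Y}.

(** By injectivity the inverse coincides near y with the local section at g y, whence its
    continuity. *)
Lemma bijective_local_homeo_homeomorphism : local_homeo f -> f @` setT = setT ->
  injective f -> homeomorphism f.
Proof.
move=> hf sf injf; have [cf lf] := hf.
have /(@choice Y X)[g fg] : forall y, exists x, f x = y.
  by move=> y; have [x _ fx] : (f @` setT) y by [rewrite sf]; exists x.
have gf x : g (f x) = x by apply: injf; rewrite fg.
apply: (local_section_homeo_on hf (s := g)); split=> //; try exact: openT.
move=> y _; have [V [W [s [Vx [oV oW Vs Ws cs]]]]] := lf (g y).
have Wy : W y by have [] := Vs _ Vx; rewrite fg.
apply: (near_eq_continuous (q' := s)); last exact: cs.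
apply: filterS (open_nbhs_nbhs (conj oW Wy)) => v Wv.
by apply: injf; rewrite fg; case: (Ws v Wv).
Qed.

Lemma homeomorphism_covering : local_homeo f -> homeomorphism f -> covering_projection f.
Proof.
move=> [cf _] hom; have [sf _ _] := hom; split=> // y.
exists setT; split=> //; [exact: openT|exists [set setT]; split].
- by rewrite bigcup_set1 preimage_setT.
- by move=> V ->; split=> //; exact: openT.
- by move=> V V' -> ->.
Qed.

Lemma homeomorphism_proper : homeomorphism f -> proper_map f.
Proof.
move=> [_ _ [g [_ gf fg cg]]] K cK.
have -> : f @^-1` K = g @` K.
  apply/seteqP; split=> [x Kfx|_ [y Ky <-]]; first by exists (f x) => //; exact: gf.
  by rewrite /= fg.
by apply: continuous_compact cK; apply: continuous_subspaceW cg.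
Qed.

Lemma path01_compact (p : R -> Y) : is_path01 p -> compact (p @` `[0, 1]).
Proof. by move=> cp; apply: continuous_compact cp _; exact: segment_compact. Qed.

(** The lift stays in the preimage of the image of [p], which is compact; a cluster point of [q]
    along times increasing to [b] is the required accumulation point. *)
Lemma proper_continuation (p : R -> Y) : proper_map f -> is_path01 p ->
  continuation_property f p.
Proof.
move=> prop cp; apply: accumulation_continuation => b q /andP[b0 b1] [_ fq].
have := prop _ (path01_compact cp) (q @ b^'-) _.
have nb (e : R) : 0 < e -> \forall t \near b^'-, 0 <= t < b /\ b - e < t.
  move=> e0; exists (Num.min b e) => /= [|t]; first by rewrite lt_min b0.
  rewrite /= distrC ltr_norml => /andP[h1 _] tb.
  have : Num.min b e <= b by rewrite ge_min lexx.
  have : Num.min b e <= e by rewrite ge_min lexx orbT.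
  by move=> ? ?; split; [apply/andP; split|]; lra.
case.
  apply: filterS (nb 1 ltr01) => t [/andP[t0 tb] _] /=.
  by exists t; [rewrite /= in_itv/= t0; lra|rewrite fq// t0].
move=> x [_ clx]; exists x => N nN e e0.
have [|_ [[t ht <-] Nz]] := clx (q @` [set t | 0 <= t < b /\ b - e < t]) N _ nN;
  last by exists t.
apply: filterS (nb e e0) => t ht; exact: imageP.
Qed.

End GlobalHomeomorphism.

(** * Implications among the eight conditions *)

Unset Implicit Arguments.

Theorem theorem6 (R : realType) (X Y : metricType R) (f : X -> Y) :
  complete_metric X -> complete_metric Y ->
  no_isolated_points X -> (exists x : X, True) ->
  local_quasi_isometry f ->
  path_connected Y -> locally_R_contractible Y ->
  let c1 := covering_projection f in
  let c2 := forall p : R -> Y, rectifiable_path01 p -> continuation_property f p in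
  let c3 := forall (a b : R) (q : R -> X), a < b ->
              {within `[a, b[%classic, continuous q} ->
              (hpath_length (f \o q) a b < +oo)%E ->
              (hpath_length q a b < +oo)%E in
  let c4 := forall p : R -> Y, rectifiable_path01 p -> bounded_path_lifting f p in
  let c5 := exists w : R -> R, weight w /\
              forall p : R -> Y, rectifiable_path01 p -> bounded_path_lifting_w f w p in
  let c6 := homeomorphism f in
  let c7 := proper_map f in
  let c8 := forall K : set Y, compact K -> exists alpha : R, 0 < alpha /\
              forall x : X, K (f x) -> (alpha%:E <= Dminus f x)%E in
  [/\ c1 <-> c2, c1 <-> c3, c1 <-> c4 & c1 <-> c5] /\
  (connected [set: X] ->
   (simply_connected Y \/
    exists (x0 : X) (y0 : Y), [/\ pi1_isomorphic x0 y0, pi1_finite x0 & pi1_finite y0]) ->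
   [/\ c1 <-> c6, c1 <-> c7 & c1 <-> c8]).
Proof.
move=> cX cY _ [x0 _] lqi pY lcY c1 c2 c3 c4 c5 c6 c7 c8.
have hf := local_quasi_isometry_homeo lqi; have [cf _] := hf.
have c12 : c1 -> c2.
  move=> h1 p [cp _]; apply: continues_continuation.
  exact: (covering_continues hf h1 (clamp_path_continuous cp)).
have c2_lift : c2 -> @liftable_contractible R X Y f.
  by move=> h2; exact: rectifiable_liftable_contractible hf lcY h2.
have c21 : c2 -> c1.
  move=> /c2_lift; apply: liftable_contractible_covering => //; by exists x0.
have c24 : c2 -> c4.
  by move=> h2 p rp; apply: continuation_bounded_lifting (h2 p rp) => //; case: rp.
have c42 : c4 -> c2 by move=> h4 p rp; exact: bounded_lifting_continuation (h4 p rp).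
have c43 : c4 -> c3 by move=> h4; exact: bounded_lifting_finite_length h4.
have c32 : c3 -> c2 by move=> h3 p rp; exact: finite_length_continuation rp.
have c45 : c4 -> c5.
  move=> h4; exists (fun=> 1); split; first exact: weight_cst1.
  move=> p rp b q b01 ql; have [alpha [a0 Ha]] := h4 p rp b q b01 ql.
  by exists x0, alpha; split=> // x /Ha; rewrite mule1.
have c54 : c5 -> c4.
  by move=> [w [hw h5]] p rp; exact: weighted_bounded_lifting hw rp (h5 p rp).
split; first by split; tauto.
move=> conX hpi.
have c61 : c6 -> c1 by exact: homeomorphism_covering.
have c16 : c1 -> c6.
  move=> h1; have [_ sf _] := h1.
  have pX := liftable_contractible_path_connected hf conX (c2_lift (c12 h1)).
  (* Taken from the covering itself: (2) reaches only rectifiable paths, and the rows of a homotopy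
     need not be rectifiable. *)
  have cont p : continuous p -> continues (f := f) p by move=> cp; exact: (covering_continues hf h1 cp).
  apply: bijective_local_homeo_homeomorphism => //.
  case: hpi => [sc|[x1 [y1 [iso fin _]]]]; first exact: simply_connected_injective sc.
  exact: finite_pi1_injective iso fin.
have c67 : c6 -> c7 by exact: homeomorphism_proper.
have c72 : c7 -> c2 by move=> h7 p [cp _]; exact: proper_continuation.
have c78 : c7 -> c8.
  move=> h7 K /h7 cK; have [alpha a0 Ha] := compact_Dminus lqi cK.
  by exists alpha; split=> // x; exact: Ha.
have c84 : c8 -> c4.
  move=> h8 p [cp _] b q /andP[b0 b1] [_ fq].
  have [alpha [a0 Ha]] := h8 _ (path01_compact cp); exists alpha; split=> // x [t].
  rewrite /= in_itv/= => tb <-; apply: Ha; rewrite fq//.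
  by exists t => //; rewrite /= in_itv/=; apply/andP; split; case/andP: tb => ? ?; lra.
by split; tauto.
Qed.
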